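(* Let $M$ be a generalized almost complex manifold, with structure $E\subset T_{\mathbb C}M\oplus T^*_{\mathbb C}M$ and Courant sheaf $\mathcal{COU}_M$. (a) The Courant sheaf is closed under componentwise addition, and under the multiplication defined by $(f,X)\cdot(g,Y)=(f\cdot g,\,f\cdot Y+g\cdot X)$. Thus $\mathcal{COU}_M$ is a sheaf of commutative unital $\mathbb C$-algebras. In particular, the product of two admissible functions is admissible. (b) Furthermore, $\mathcal{COU}_M$ is a sheaf of local rings. Namely, if $m\in M$, then the maximal ideal of the stalk $\mathcal{COU}_{M,m}$ is formed by the germs of all sections $(f,X)$ of $\mathcal{COU}_M$, defined near $m$, such that $f(m)=0$. (c) Assume that $M$ is a generalized complex manifold (i.e. that $E$ is integrable). Then the Courant sheaf is also closed under the bracket defined by $\{(f,X),(g,Y)\}=\bigl(\tfrac12(X(g)-Y(f)),[X,Y]\bigr)=\bigl(X(g),[X,Y]\bigr)$ (the last equality holding for sections of $\mathcal{COU}_M$), where $[\cdot,\cdot]$ is the usual Lie bracket of vector fields. With this operation, $\mathcal{COU}_M$ is a sheaf of Poisson algebras.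
   Context: $M$ is a $C^\infty$ finite-dimensional real manifold; $T_{\mathbb C}M$, $T^*_{\mathbb C}M$ are the complexified tangent and cotangent bundles, and $C^\infty_M$ is the sheaf of complex-valued smooth functions. The pairing on $T_{\mathbb C}M\oplus T^*_{\mathbb C}M$ is $\langle X+\xi,Y+\eta\rangle=-\tfrac12(\xi(Y)+\eta(X))$. A generalized almost complex structure on $M$ is a smooth complex subbundle $E\subset T_{\mathbb C}M\oplus T^*_{\mathbb C}M$ that is maximally isotropic for this pairing and satisfies $E\cap\overline E=0$; then $M$ is a generalized almost complex manifold. The Courant bracket is $[X\oplus\xi,Y\oplus\eta]_{\mathrm{cou}}=[X,Y]+\mathcal L_X\eta-\mathcal L_Y\xi+\tfrac12d(\iota_Y\xi-\iota_X\eta)$. $E$ is integrable, and $M$ is a generalized complex manifold, if the sheaf of sections of $E$ is closed under the Courant bracket. The Courant sheaf of $M$ is the subsheaf $\mathcal{COU}_M$ of $C^\infty_M\oplus T_{\mathbb C}M$ given for $U\subseteq M$ open by $\mathcal{COU}_M(U)=\{(f,X)\in C^\infty_M(U)\oplus\Gamma(U,T_{\mathbb C}M): df+X\in\Gamma(U,\overline E)\}$. A function $f\in C^\infty_M(U)$ is admissible if there is $X\in\Gamma(U,T_{\mathbb C}M)$ with $(f,X)\in\mathcal{COU}_M(U)$. *)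

(* Defs.v *)
From HB Require Import structures.
From mathcomp Require Import all_boot all_order all_algebra.
From mathcomp Require Import all_classical all_reals all_analysis.
From mathcomp Require Import complex.

Set Implicit Arguments.
Unset Strict Implicit.
Unset Printing Implicit Defensive.

Import Order.TTheory GRing.Theory Num.Theory.
Import numFieldNormedType.Exports.

Local Open Scope classical_set_scope.
Local Open Scope ring_scope.

Fixpoint Ck {R : realType} {n : nat} (k : nat) (W : set 'rV[R]_n)
    (f : 'rV[R]_n -> R) : Prop :=
  (forall x, W x -> {for x, continuous f}) /\
  match k with
  | 0 => True
  | k'.+1 => forall i : 'I_n,
      (forall x, W x -> derivable f x 'e_i) /\ Ck k' W ('D_('e_i) f)
  end.

Definition Cinfty {R : realType} {n : nat} (W : set 'rV[R]_n)
  (f : 'rV[R]_n -> R) : Prop := forall k, Ck k W f.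

(* [chart_map] is only meaningful on [chart_dom] and [chart_inv] only on the
   image of [chart_dom]. *)
Record chart (R : realType) (n : nat) (T : topologicalType) := Chart {
  chart_dom : set T;
  chart_map : T -> 'rV[R]_n;
  chart_inv : 'rV[R]_n -> T }.

Definition chart_im {R n T} (c : chart R n T) (U : set T) : set 'rV[R]_n :=
  chart_map c @` (U `&` chart_dom c).

Record is_chart {R n T} (c : chart R n T) : Prop := {
  chart_open_dom : open (chart_dom c);
  chart_open_im : open (chart_im c setT);
  chart_mapK : forall x, chart_dom c x -> chart_inv c (chart_map c x) = x;
  chart_map_cont :
    forall x, chart_dom c x -> {for x, continuous (chart_map c)};
  chart_inv_cont :
    forall y, chart_im c setT y -> {for y, continuous (chart_inv c)} }.

Record manifold (R : realType) (n : nat) := Manifold {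
  mcarrier :> topologicalType;
  mhausdorff : hausdorff_space mcarrier;
  msecond_countable : @second_countable mcarrier;
  atlas : set (chart R n mcarrier);
  atlas_chart : forall c, atlas c -> is_chart c;
  atlas_cover : forall x : mcarrier, exists2 c, atlas c & chart_dom c x;
  atlas_smooth : forall c d, atlas c -> atlas d -> forall j : 'I_n,
    Cinfty (chart_im c (chart_dom d))
      (fun y => chart_map d (chart_inv c y) 0 j) }.

(* An algebra is given by operations on an ambient type S together with the
   subset A of S that carries the algebra. *)
Record alg_ops (K : pzRingType) (S : Type) := AlgOps {
  azero : S;
  aone : S;
  aadd : S -> S -> S;
  aopp : S -> S;
  amul : S -> S -> S;
  ascale : K -> S -> S }.

Record is_comm_algebra {K : pzRingType} {S : Type} (A : set S)
    (o : alg_ops K S) : Prop := {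
  alg_zero_in : A (azero o);
  alg_one_in : A (aone o);
  alg_add_in : forall s t, A s -> A t -> A (aadd o s t);
  alg_opp_in : forall s, A s -> A (aopp o s);
  alg_mul_in : forall s t, A s -> A t -> A (amul o s t);
  alg_scale_in : forall a s, A s -> A (ascale o a s);
  alg_addA : forall s t u, A s -> A t -> A u ->
    aadd o s (aadd o t u) = aadd o (aadd o s t) u;
  alg_addC : forall s t, A s -> A t -> aadd o s t = aadd o t s;
  alg_add0 : forall s, A s -> aadd o (azero o) s = s;
  alg_addN : forall s, A s -> aadd o (aopp o s) s = azero o;
  alg_mulA : forall s t u, A s -> A t -> A u ->
    amul o s (amul o t u) = amul o (amul o s t) u;
  alg_mulC : forall s t, A s -> A t -> amul o s t = amul o t s;
  alg_mul1 : forall s, A s -> amul o (aone o) s = s;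
  alg_mulD : forall s t u, A s -> A t -> A u ->
    amul o (aadd o s t) u = aadd o (amul o s u) (amul o t u);
  alg_scale1 : forall s, A s -> ascale o 1 s = s;
  alg_scaleA : forall a b s, A s -> ascale o a (ascale o b s) = ascale o (a * b) s;
  alg_scaleDr : forall a s t, A s -> A t ->
    ascale o a (aadd o s t) = aadd o (ascale o a s) (ascale o a t);
  alg_scaleDl : forall a b s, A s ->
    ascale o (a + b) s = aadd o (ascale o a s) (ascale o b s);
  alg_scaleM : forall a s t, A s -> A t ->
    ascale o a (amul o s t) = amul o (ascale o a s) t }.

Record is_poisson_algebra {K : pzRingType} {S : Type} (A : set S)
    (o : alg_ops K S) (br : S -> S -> S) : Prop := {
  poisson_algebra : is_comm_algebra A o;
  poisson_in : forall s t, A s -> A t -> A (br s t);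
  poisson_linear : forall a s t u, A s -> A t -> A u ->
    br (aadd o (ascale o a s) t) u = aadd o (ascale o a (br s u)) (br t u);
  poisson_alternating : forall s, A s -> br s s = azero o;
  poisson_antisym : forall s t, A s -> A t -> br s t = aopp o (br t s);
  poisson_jacobi : forall s t u, A s -> A t -> A u ->
    aadd o (br s (br t u)) (aadd o (br t (br u s)) (br u (br s t))) = azero o;
  poisson_leibniz : forall s t u, A s -> A t -> A u ->
    br s (amul o t u) = aadd o (amul o (br s t) u) (amul o t (br s u)) }.

Record is_ideal {K : pzRingType} {S : Type} (A : set S) (o : alg_ops K S)
    (I : set S) : Prop := {
  ideal_sub : I `<=` A;
  ideal_zero : I (azero o);
  ideal_add : forall s t, I s -> I t -> I (aadd o s t);
  ideal_mul : forall s t, A s -> I t -> I (amul o s t) }.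

Definition is_maximal_ideal {K : pzRingType} {S : Type} (A : set S)
    (o : alg_ops K S) (I : set S) : Prop :=
  [/\ is_ideal A o I, I <> A &
      forall J, is_ideal A o J -> I `<=` J -> J <> A -> J = I].

Definition is_local_ring_with {K : pzRingType} {S : Type} (A : set S)
    (o : alg_ops K S) (I : set S) : Prop :=
  [/\ is_comm_algebra A o, is_maximal_ideal A o I &
      forall J, is_maximal_ideal A o J -> J = I].

(* A presheaf on T is given by its sets of sections F U over the open sets U,
   all inside one type S, and its restriction maps: res V restricts to V. *)
Record is_sheaf {T : topologicalType} {S : Type} (F : set T -> set S)
    (res : set T -> S -> S) : Prop := {
  sheaf_res : forall U V s, open U -> open V -> V `<=` U -> F U s ->
    F V (res V s);
  sheaf_res_id : forall U s, open U -> F U s -> res U s = s;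
  sheaf_res_res : forall U V W s, open U -> open V -> open W ->
    W `<=` V -> V `<=` U -> F U s -> res W (res V s) = res W s;
  sheaf_glue : forall (I : Type) (V : I -> set T) (s : I -> S),
    (forall i, open (V i)) -> (forall i, F (V i) (s i)) ->
    (forall i j, res (V i `&` V j) (s i) = res (V i `&` V j) (s j)) ->
    exists! t, F (\bigcup_i V i) t /\ forall i, res (V i) t = s i }.

Record is_sheaf_of_comm_algebras {K : pzRingType} {T : topologicalType}
    {S : Type} (F : set T -> set S) (res : set T -> S -> S)
    (o : set T -> alg_ops K S) : Prop := {
  algsheaf_sheaf : is_sheaf F res;
  algsheaf_alg : forall U, open U -> is_comm_algebra (F U) (o U);
  algsheaf_res_one : forall U V, open U -> open V -> V `<=` U ->
    res V (aone (o U)) = aone (o V);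
  algsheaf_res_add : forall U V s t, open U -> open V -> V `<=` U ->
    F U s -> F U t -> res V (aadd (o U) s t) = aadd (o V) (res V s) (res V t);
  algsheaf_res_mul : forall U V s t, open U -> open V -> V `<=` U ->
    F U s -> F U t -> res V (amul (o U) s t) = amul (o V) (res V s) (res V t);
  algsheaf_res_scale : forall U V a s, open U -> open V -> V `<=` U ->
    F U s -> res V (ascale (o U) a s) = ascale (o V) a (res V s) }.

Record is_sheaf_of_poisson_algebras {K : pzRingType} {T : topologicalType}
    {S : Type} (F : set T -> set S) (res : set T -> S -> S)
    (o : set T -> alg_ops K S) (br : S -> S -> S) : Prop := {
  poissonsheaf_alg : is_sheaf_of_comm_algebras F res o;
  poissonsheaf_poisson : forall U, open U -> is_poisson_algebra (F U) (o U) br;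
  poissonsheaf_res : forall U V s t, open U -> open V -> V `<=` U ->
    F U s -> F U t -> res V (br s t) = br (res V s) (res V t) }.

Section Stalk.
Context {K : pzRingType} {T : topologicalType} {S : Type}.
Variables (F : set T -> set S) (res : set T -> S -> S).
Variables (o : set T -> alg_ops K S) (m : T).

Definition local_section (p : set T * S) : Prop :=
  [/\ open p.1, p.1 m & F p.1 p.2].

(* The germ of p is the equivalence class of all local sections that agree
   with p near m. *)
Definition germ (p : set T * S) : set (set T * S) :=
  [set q | local_section q /\
    exists W, [/\ open W, W m, W `<=` p.1 `&` q.1 & res W p.2 = res W q.2]].

Definition stalk : set (set (set T * S)) := [set germ p | p in local_section].

Definition germ_map (op : set T -> S -> S) (g : set (set T * S)) :
    set (set T * S) :=
  \bigcup_(p in g) germ (p.1, op p.1 p.2).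

Definition germ_map2 (op : set T -> S -> S -> S) (g h : set (set T * S)) :
    set (set T * S) :=
  \bigcup_(p in g) \bigcup_(q in h)
    let W := p.1 `&` q.1 in germ (W, op W (res W p.2) (res W q.2)).

Definition stalk_ops : alg_ops K (set (set T * S)) := {|
  azero := germ (setT, azero (o setT));
  aone := germ (setT, aone (o setT));
  aadd := germ_map2 (fun U => aadd (o U));
  aopp := germ_map (fun U => aopp (o U));
  amul := germ_map2 (fun U => amul (o U));
  ascale := fun a => germ_map (fun U => ascale (o U) a) |}.

End Stalk.

(* Raw operators: a tangent vector acts on complex functions, a covector on
   tangent vectors.  The point and the laws are imposed by [is_tangent] and
   [is_cotangent].  The alias R[i]^o makes these function spaces complex vector
   spaces. *)
Notation cfunction R M := (M -> R[i]^o)%type.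
Notation tvector R M := (cfunction R M -> R[i]^o)%type.
Notation covector R M := (tvector R M -> R[i]^o)%type.
Notation gvector R M := (tvector R M * covector R M)%type.

Section Bundles.
Context {R : realType} {n : nat} (M : manifold R n).

Local Notation C := (R[i]^o)%type.
Local Notation func := (cfunction R M).
Local Notation tvec := (tvector R M).
Local Notation cvec := (covector R M).
Local Notation gvec := (gvector R M).

Implicit Types (U V : set M) (m x : M) (f g h : func).

Definition smooth_on U f : Prop := forall c, atlas c ->
  Cinfty (chart_im c U) (fun y => complex.Re (f (chart_inv c y))) /\
  Cinfty (chart_im c U) (fun y => complex.Im (f (chart_inv c y))).

Definition smooth_at m f : Prop := exists U, [/\ open U, U m & smooth_on U f].

(* The fibre at m of the complexified tangent bundle: the C-linear derivations
   at m of the algebra of germs at m of complex-valued smooth functions.  The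
   value on functions that are not smooth near m is irrelevant and normalized
   to 0, so that equal tangent vectors are equal operators. *)
Record is_tangent m (D : tvec) : Prop := {
  tangent_linear : forall (a : C) f g, smooth_at m f -> smooth_at m g ->
    D (a *: f + g) = a * D f + D g;
  tangent_leibniz : forall f g, smooth_at m f -> smooth_at m g ->
    D (f * g) = D f * g m + f m * D g;
  tangent_germ : forall f g, smooth_at m f -> smooth_at m g ->
    (\forall x \near m, f x = g x) -> D f = D g;
  tangent_junk : forall f, ~ smooth_at m f -> D f = 0 }.

(* The fibre at m of the complexified cotangent bundle: the complex dual of
   the previous fibre, normalized to 0 on operators that are not in it. *)
Record is_cotangent m (xi : cvec) : Prop := {
  cotangent_linear : forall (a : C) D D', is_tangent m D -> is_tangent m D' ->
    xi (a *: D + D') = a * xi D + xi D';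
  cotangent_junk : forall D, ~ is_tangent m D -> xi D = 0 }.

Definition gfibre m : set gvec :=
  [set p | is_tangent m p.1 /\ is_cotangent m p.2].

(* Sections over U are encoded as maps on the whole of M that vanish outside U,
   so that equal sections are equal maps. *)

Definition restr {V : zmodType} U (s : M -> V) : M -> V :=
  patch (fun=> 0) U s.

Definition smooth_fun U : set func :=
  [set f | smooth_on U f /\ restr U f = f].

Definition tapply (X : M -> tvec) f : func := fun x => X x f.

Definition contract (X : M -> tvec) (xi : M -> cvec) : func :=
  fun x => xi x (X x).

Definition vector_field U : set (M -> tvec) := [set X |
  [/\ restr U X = X,
      forall x, U x -> is_tangent x (X x) &
      forall V f, open V -> V `<=` U -> smooth_on V f ->
        smooth_on V (tapply X f)]].

Definition one_form U : set (M -> cvec) := [set xi |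
  [/\ restr U xi = xi,
      forall x, U x -> is_cotangent x (xi x) &
      forall V X, open V -> V `<=` U -> vector_field V X ->
        smooth_on V (contract X xi)]].

Definition gsection U : set (M -> gvec) := [set e |
  vector_field U (fun x => (e x).1) /\ one_form U (fun x => (e x).2)].

Definition lie (X Y : M -> tvec) : M -> tvec := fun x f =>
  if `[< smooth_at x f >] then X x (tapply Y f) - Y x (tapply X f) else 0.

Definition ext_d U f : M -> cvec :=
  restr U (fun x (D : tvec) => if `[< is_tangent x D >] then D f else 0).

(* The Lie derivative of eta along X over U is the 1-form zeta characterized by
   zeta(W) = X(eta(W)) - eta([X, W]) for all local vector fields W. *)
Definition is_lie_derivative U (X : M -> tvec) (eta zeta : M -> cvec) : Prop :=
  one_form U zeta /\
  forall V W, open V -> V `<=` U -> vector_field V W -> forall x, V x ->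
    zeta x (W x) = X x (contract W eta) - eta x (lie X W x).

Definition is_courant_bracket U (p q b : M -> gvec) : Prop :=
  let X x := (p x).1 in let xi x := (p x).2 in
  let Y x := (q x).1 in let eta x := (q x).2 in
  exists LXeta LYxi : M -> cvec,
    [/\ is_lie_derivative U X eta LXeta,
        is_lie_derivative U Y xi LYxi &
        b = fun x => (lie X Y x,
          LXeta x - LYxi x +
          2^-1 *: ext_d U (contract Y xi - contract X eta) x)].

Definition gpairing (p q : gvec) : C := - 2^-1 * (p.2 q.1 + q.2 p.1).

Definition is_subspace (A : set gvec) : Prop :=
  A 0 /\ forall (a : C) p q, A p -> A q -> A (a *: p + q).

Definition isotropic (A : set gvec) : Prop :=
  forall p q, A p -> A q -> gpairing p q = 0.

Definition maximally_isotropic m (A : set gvec) : Prop :=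
  [/\ is_subspace A, A `<=` gfibre m, isotropic A &
      forall B, is_subspace B -> B `<=` gfibre m -> isotropic B ->
        A `<=` B -> B = A].

Definition conj_func f : func := fun x => conjc (f x).
Definition conj_tvec (D : tvec) : tvec := fun f => conjc (D (conj_func f)).
Definition conj_cvec (xi : cvec) : cvec := fun D => conjc (xi (conj_tvec D)).
Definition conj_bundle (E : M -> set gvec) : M -> set gvec := fun m =>
  [set (conj_tvec p.1, conj_cvec p.2) | p in E m].

Definition smooth_subbundle (E : M -> set gvec) : Prop :=
  forall m, exists U (k : nat) (e : 'I_k -> M -> gvec),
    [/\ open U, U m, forall i, gsection U (e i) &
        forall x, U x ->
          (forall a : 'I_k -> C,
             \sum_i a i *: e i x = 0 -> forall i, a i = 0) /\
          E x = [set p | exists a : 'I_k -> C, p = \sum_i a i *: e i x]].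

Record generalized_almost_complex (E : M -> set gvec) : Prop := {
  gac_subbundle : smooth_subbundle E;
  gac_isotropic : forall m, maximally_isotropic m (E m);
  gac_conj : forall m, E m `&` conj_bundle E m = [set 0] }.

Definition bundle_section (E : M -> set gvec) U : set (M -> gvec) :=
  [set e | gsection U e /\ forall x, U x -> E x (e x)].

Definition integrable_structure (E : M -> set gvec) : Prop :=
  forall U, open U -> forall p q b,
    bundle_section E U p -> bundle_section E U q ->
    is_courant_bracket U p q b -> bundle_section E U b.

Local Notation sect := (func * (M -> tvec))%type.

Definition COU (E : M -> set gvec) U : set sect := [set s |
  [/\ smooth_fun U s.1, vector_field U s.2 &
      bundle_section (conj_bundle E) U (fun x => (s.2 x, ext_d U s.1 x))]].

Definition admissible (E : M -> set gvec) U f : Prop :=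
  smooth_fun U f /\
  exists X : M -> tvec, vector_field U X /\ COU E U (f, X).

Definition cou_res U (s : sect) : sect := (restr U s.1, restr U s.2).

Definition cou_mul (s t : sect) : sect :=
  (s.1 * t.1, fun x => s.1 x *: t.2 x + t.1 x *: s.2 x).

Definition cou_ops U : alg_ops R[i] sect := {|
  azero := 0;
  aone := (restr U (1 : func), 0);
  aadd := fun s t => s + t;
  aopp := fun s => - s;
  amul := cou_mul;
  ascale := fun a s => a *: s |}.

Definition cou_bracket (s t : sect) : sect :=
  (2^-1 *: (tapply s.2 t.1 - tapply t.2 s.1), lie s.2 t.2).

Definition vanishing_germs (E : M -> set gvec) m : set (set (set M * sect)) :=
  [set germ (COU E) cou_res m p |
    p in [set p | local_section (COU E) m p /\ p.2.1 m = 0]].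

End Bundles.

(* Main.v *)
(* Write a section of the Courant sheaf as (f, X) with (X, df) in conj E.
   Sums and products stay in the sheaf because d is a derivation and the fibres
   of conj E are subspaces.  If f(m) <> 0, then (1/f, - X/f^2) is an inverse of
   (f, X) near m, so every germ outside the vanishing ideal is a unit.
   Isotropy of conj E says X(g) = - Y(f).  By Cartan's formula L_X dg = d(X(g)),
   the Courant bracket of (X, df) and (Y, dg) is
   ([X, Y], d((X(g) - Y(f)) / 2)), so integrability of E, conjugated, is closure
   under the bracket.  The function component of the Jacobi identity is isotropy
   applied to {(f, X), (g, Y)} and (h, Z). *)

(* Tangent vectors are operators on all functions on M, and sections are total maps that vanish
   outside their open set. An identity valid only on an open set therefore cannot be substituted
   under a tangent vector. Both functions must first be shown smooth at the point and equal near it;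
   only then does [tangent_germ] permit the replacement. This obstacle accounts for most side goals
   below. Charts serve only to establish continuity and the closure properties of smooth functions.
   From there on vector fields are handled as derivations, without coordinates: even the
   differential of 1/f is obtained by applying a derivation to f (1/f) = 1. The Jacobi identity
   depends on closure under the bracket and not only on isotropy, because a bracket must be known to
   be a section before isotropy can be applied to it. *)
Require Import Defs.
From HB Require Import structures.
From mathcomp Require Import all_boot all_order all_algebra.
From mathcomp Require Import all_classical all_reals all_analysis.
From mathcomp Require Import complex ring.

Set Implicit Arguments.
Unset Strict Implicit.
Unset Printing Implicit Defensive.

Import Order.TTheory GRing.Theory Num.Theory.
Import numFieldNormedType.Exports.

Local Open Scope classical_set_scope.
Local Open Scope ring_scope.

(** * Smooth functions *)

Section Calculus.
Context {R : realType} {n : nat}.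
Implicit Types (W : set 'rV[R]_n) (f g : 'rV[R]_n -> R).

(** Every clause of [Ck] is a condition at single points on one globally defined function and its
    globally defined partial derivatives. The sets W' therefore need be neither open nor contained
    in W. *)
Lemma Ck_pointwise k W f : (forall x, W x -> exists2 W', W' x & Ck k W' f) ->
  Ck k W f.
Proof.
elim: k W f => [|k IH] W f H /=; split.
- by move=> x /H[W' W'x [+ _]]; apply.
- by [].
- by move=> x /H[W' W'x [+ _]]; apply.
- move=> i; split; first by move=> x /H[W' W'x [_ /(_ i)[+ _]]]; apply.
  apply: IH => x /H[W' W'x [_ /(_ i)[_ ?]]]; by exists W'.
Qed.

Lemma CkW k W f : Ck k.+1 W f -> Ck k W f.
Proof.
elim: k W f => [|k IH] W f; first by case.
by move=> [fc H]; split=> // i; have [fd /IH] := H i.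
Qed.

Lemma near_open_eq (T : topologicalType) (U : Type) (A : set T) (f g : T -> U) x :
  open A -> A x -> (forall y, A y -> f y = g y) -> \forall y \near x, f y = g y.
Proof. by move=> oA Ax fg; apply: filterS (open_nbhs_nbhs (conj oA Ax)). Qed.

(** Openness turns equality on W into equality near each point of W, which continuity and partial
    derivatives respect. The partial derivatives again agree on W, so the induction continues. *)
Lemma eq_Ck k W f g : open W -> (forall x, W x -> f x = g x) ->
  Ck k W f -> Ck k W g.
Proof.
elim: k f g => [|k IH] f g oW fg [fc fH]; split=> //.
1,2: move=> x Wx; have fgx := near_open_eq oW Wx fg;
  rewrite /prop_for /continuous_at -fg //;
  exact: cvg_trans (near_eq_cvg fgx) (fc x Wx).
- move=> i; have [fd fk] := fH i; split.
    move=> x Wx; apply: near_eq_derivable (fd x Wx).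
    exact: near_open_eq oW Wx fg.
  apply: IH fk => // x Wx; apply: near_eq_derive.
  exact: near_open_eq oW Wx fg.
Qed.

Lemma Ck_cst k W (c : R) : Ck k W (cst c).
Proof.
elim: k W c => [|k IH] W c; split=> //; try by move=> x _; exact: cst_continuous.
move=> i; split; first by move=> x _; exact: derivable_cst.
rewrite (_ : 'D_('e_i) _ = cst 0); first exact: IH.
by apply/funext => x; rewrite derive_cst.
Qed.

Lemma CkD k W f g : open W -> Ck k W f -> Ck k W g -> Ck k W (f + g).
Proof.
move=> oW; elim: k f g => [|k IH] f g [fc fH] [gc gH]; split=> //;
  try by move=> x Wx; apply: continuousD; [exact: fc|exact: gc].
move=> i; have [fd fk] := fH i; have [gd gk] := gH i; split.
  by move=> x Wx; exact: derivableD (fd x Wx) (gd x Wx).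
apply: eq_Ck oW _ (IH _ _ fk gk) => x Wx.
by rewrite deriveD; [|exact: fd|exact: gd].
Qed.

Lemma CkM k W f g : open W -> Ck k W f -> Ck k W g -> Ck k W (f * g).
Proof.
move=> oW; elim: k f g => [|k IH] f g fS gS; case: (fS) => fc fH;
  case: (gS) => gc gH; split=> //;
  try by move=> x Wx; apply: continuousM; [exact: fc|exact: gc].
move=> i; have [fd fk] := fH i; have [gd gk] := gH i; split.
  by move=> x Wx; exact: derivableM (fd x Wx) (gd x Wx).
apply: (eq_Ck (f := f * 'D_('e_i) g + g * 'D_('e_i) f)) => //.
  by move=> x Wx; rewrite deriveM; [|exact: fd|exact: gd].
(* Each product pairs a derivative, of order k, with an undifferentiated factor; [CkW] lowers the
   latter to the same order. *)
by apply: CkD => //; apply: IH => //; exact: CkW.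
Qed.

Lemma CkN k W f : open W -> Ck k W f -> Ck k W (- f).
Proof.
move=> oW fk; apply: (eq_Ck (f := cst (-1) * f)) => //.
  by move=> x _; rewrite [LHS]mulN1r.
by apply: CkM => //; exact: Ck_cst.
Qed.

(** The inverse reappears in its own derivative, - (1/f)^2 times that of f, so its regularity is
    bootstrapped one order at a time. *)
Lemma CkV k W f : open W -> (forall x, W x -> f x != 0) -> Ck k W f ->
  Ck k W (fun x => (f x)^-1).
Proof.
move=> oW f0; elim: k => [|k IH] fS; case: (fS) => fc fH; split=> //;
  try by move=> x Wx; apply: continuousV; [exact: f0|exact: fc].
move=> i; have [fd fk] := fH i; split.
  by move=> x Wx; exact: derivableV (f0 x Wx) (fd x Wx).
pose h x := (f x)^-1; have hk : Ck k W h := IH (CkW fS).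
apply: (eq_Ck (f := - (h * h * 'D_('e_i) f))) => //.
  move=> x Wx; rewrite deriveV; [|exact: f0|exact: fd].
  by rewrite expr2 invfM scaleNr.
by apply: CkN => //; apply: CkM => //; apply: CkM.
Qed.

End Calculus.

(** * Complex-valued smooth functions on a manifold *)

Section SmoothFunctions.
Context {R : realType} {n : nat} (M : manifold R n).
Local Notation C := (R[i]^o)%type.
Local Notation func := (cfunction R M).
Implicit Types (U V : set M) (m x : M) (f g h : func).

(** Near a point of the image, [chart_inv] is continuous and inverts the chart, so the points that
    it sends into U form a neighbourhood. Intersecting with the open image of the whole domain
    discards the points where [chart_inv] is meaningless. *)
Lemma open_chart_im (c : chart R n M) U : is_chart c -> open U ->
  open (chart_im c U).
Proof.
move=> cc oU; rewrite openE => y [x [Ux cx] <-].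
have cxT : chart_im c setT (chart_map c x) by exists x.
have Uinv : nbhs (chart_map c x) (chart_inv c @^-1` U).
  apply: (chart_inv_cont cc cxT); rewrite (chart_mapK cc cx).
  exact: open_nbhs_nbhs.
have imT := open_nbhs_nbhs (conj (chart_open_im cc) cxT).
apply: filterS (filterI Uinv imT) => w [/= + [z [_ cz] zw]].
by rewrite -zw (chart_mapK cc cz) => Uz; exists z.
Qed.

Lemma chart_im_inv (c : chart R n M) U y : is_chart c -> chart_im c U y ->
  U (chart_inv c y).
Proof. by move=> cc [x [Ux cx] <-]; rewrite (chart_mapK cc cx). Qed.

Lemma eq_smooth_on U f g : open U -> (forall x, U x -> f x = g x) ->
  smooth_on U f -> smooth_on U g.
Proof.
move=> oU fg fs c ca; have cc := atlas_chart ca.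
have [fr fi] := fs c ca; have oI := open_chart_im cc oU.
by split=> k; [apply: eq_Ck oI _ (fr k)|apply: eq_Ck oI _ (fi k)] => y Uy;
   rewrite fg //; exact: chart_im_inv Uy.
Qed.

Lemma smooth_on_local U f :
  (forall x, U x -> exists2 V, V x & smooth_on V f) -> smooth_on U f.
Proof.
move=> H c ca; split=> k; apply: Ck_pointwise => _ [x [/H[V Vx fs] cx] <-];
  (exists (chart_im c V); first by exists x); have [fr fi] := fs c ca.
  exact: fr.
exact: fi.
Qed.

Lemma smooth_on_subset U V f : V `<=` U -> smooth_on U f -> smooth_on V f.
Proof. by move=> VU fs; apply: smooth_on_local => x /VU; exists U. Qed.

Lemma smooth_on_cst U (a : C) : smooth_on U (cst a).
Proof. by move=> c ca; split=> k; exact: Ck_cst. Qed.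

Lemma smooth_onD U f g : open U -> smooth_on U f -> smooth_on U g ->
  smooth_on U (f + g).
Proof.
move=> oU fs gs c ca; have [fr fi] := fs c ca; have [gr gi] := gs c ca.
have oI := open_chart_im (atlas_chart ca) oU.
split=> k; [apply: eq_Ck oI _ (CkD oI (fr k) (gr k))
           |apply: eq_Ck oI _ (CkD oI (fi k) (gi k))] => y _;
  rewrite !fctE; by case: (f _) (g _) => [? ?] [? ?].
Qed.

Lemma smooth_onM U f g : open U -> smooth_on U f -> smooth_on U g ->
  smooth_on U (f * g).
Proof.
move=> oU fs gs c ca; have [fr fi] := fs c ca; have [gr gi] := gs c ca.
have oI := open_chart_im (atlas_chart ca) oU.
split=> k.
  apply: eq_Ck oI _ (CkD oI (CkM oI (fr k) (gr k))
                           (CkN oI (CkM oI (fi k) (gi k)))) => y _.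
  by rewrite !fctE; case: (f _) (g _) => [? ?] [? ?].
apply: eq_Ck oI _ (CkD oI (CkM oI (fr k) (gi k)) (CkM oI (fi k) (gr k))) => y _.
by rewrite !fctE; case: (f _) (g _) => [? ?] [? ?].
Qed.

Lemma smooth_onZ U (a : C) f : open U -> smooth_on U f -> smooth_on U (a *: f).
Proof. by move=> oU; apply: (smooth_onM (f := cst a)) => //; exact: smooth_on_cst. Qed.

Lemma smooth_onN U f : open U -> smooth_on U f -> smooth_on U (- f).
Proof. by move=> oU fs; rewrite -scaleN1r; exact: smooth_onZ. Qed.

Lemma smooth_onB U f g : open U -> smooth_on U f -> smooth_on U g ->
  smooth_on U (f - g).
Proof. by move=> oU fs gs; apply: smooth_onD => //; exact: smooth_onN. Qed.

Lemma smooth_on_conj U f : open U -> smooth_on U f -> smooth_on U (conj_func f).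
Proof.
move=> oU fs c ca; have [fr fi] := fs c ca.
have oI := open_chart_im (atlas_chart ca) oU.
split=> k; [apply: eq_Ck oI _ (fr k)|apply: eq_Ck oI _ (CkN oI (fi k))] => y _;
  by rewrite ?fctE /conj_func; case: (f _).
Qed.

Lemma smooth_onV U f : open U -> (forall x, U x -> f x != 0) ->
  smooth_on U f -> smooth_on U (fun x => (f x)^-1).
Proof.
move=> oU f0 fs c ca; have [fr fi] := fs c ca; have cc := atlas_chart ca.
have oI := open_chart_im cc oU.
(* Since 1/(a + ib) = (a - ib)/(a^2 + b^2), only the real function a^2 + b^2 has to be inverted. *)
have N0 y : chart_im c U y -> complex.Re (f (chart_inv c y)) * complex.Re (f (chart_inv c y)) +
    complex.Im (f (chart_inv c y)) * complex.Im (f (chart_inv c y)) != 0.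
  move=> /(chart_im_inv cc)/f0; case: (f _) => a b /=.
  by rewrite eq_complex /= -!expr2 paddr_eq0 ?sqr_ge0// !sqrf_eq0.
have N k := CkV oI N0 (CkD oI (CkM oI (fr k) (fr k)) (CkM oI (fi k) (fi k))).
split=> k.
  apply: eq_Ck oI _ (CkM oI (fr k) (N k)) => y _.
  by rewrite !fctE; case: (f _) => ? ?.
apply: eq_Ck oI _ (CkN oI (CkM oI (fi k) (N k))) => y _.
by rewrite !fctE; case: (f _) => ? ?.
Qed.

(** Smoothness says nothing directly about the topology of M. Continuity of the real and imaginary
    parts is recovered by composing their chart expressions with the chart; one of the two parts is
    nonzero at x and stays so nearby. *)
Lemma smooth_on_near_neq0 U f : open U -> smooth_on U f ->
  forall x, U x -> f x != 0 -> \forall y \near x, f y != 0.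
Proof.
move=> oU fs x Ux fx; have [c ca cx] := atlas_cover x.
have cc := atlas_chart ca; have [/(_ 0%N)[fr _] /(_ 0%N)[fi _]] := fs c ca.
have Ix : chart_im c U (chart_map c x) by exists x.
have /= mc := chart_map_cont cc cx.
have mK := chart_mapK cc cx.
have rc : {for x, continuous ((fun y => complex.Re (f (chart_inv c y))) \o chart_map c)}.
  by apply: continuous_comp => //; exact: fr.
have ic : {for x, continuous ((fun y => complex.Im (f (chart_inv c y))) \o chart_map c)}.
  by apply: continuous_comp => //; exact: fi.
have nc := open_nbhs_nbhs (conj (chart_open_dom cc) cx).
have : complex.Re (f x) != 0 \/ complex.Im (f x) != 0.
  by apply/orP; rewrite -negb_and; move: fx; case: (f x) => a b; rewrite eq_complex.
have nz (g : M -> R) : {for x, continuous g} -> g x != 0 -> \forall y \near x, g y != 0.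
  move=> gc gx; apply: (gc [set w | w != 0]); apply: open_nbhs_nbhs.
  by split=> //; exact: open_neq.
case=> [r0|i0].
  have /(nz _ rc) : complex.Re (f (chart_inv c (chart_map c x))) != 0 by rewrite mK.
  apply: filterS2 nc => y cy /=; rewrite (chart_mapK cc cy).
  by apply: contraNN => /eqP ->.
have /(nz _ ic) : complex.Im (f (chart_inv c (chart_map c x))) != 0 by rewrite mK.
apply: filterS2 nc => y cy /=; rewrite (chart_mapK cc cy).
by apply: contraNN => /eqP ->.
Qed.

End SmoothFunctions.

(** * Tangent vectors and vector fields *)

Section Tangent.
Context {R : realType} {n : nat} (M : manifold R n).
Local Notation C := (R[i]^o)%type.
Local Notation func := (cfunction R M).
Local Notation tvec := (tvector R M).
Local Notation cvec := (covector R M).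
Implicit Types (U V : set M) (m x : M) (f g h : func) (D : tvec).
Implicit Types (X Y Z : M -> tvec).

Lemma restr_in {V : zmodType} U (s : M -> V) x : U x -> restr U s x = s x.
Proof. by move=> Ux; rewrite /restr patchT// inE. Qed.

Lemma restr_out {V : zmodType} U (s : M -> V) x : ~ U x -> restr U s x = 0.
Proof. by move=> Ux; rewrite /restr patchC// inE. Qed.

Lemma restr_idP {V : zmodType} U (s : M -> V) :
  (forall x, ~ U x -> s x = 0) <-> restr U s = s.
Proof.
split=> [s0|<- x Ux]; last exact: restr_out.
apply/funext => x; have [Ux|Ux] := pselect (U x); first exact: restr_in.
by rewrite restr_out// s0.
Qed.

Lemma restr_restr {V : zmodType} U W (s : M -> V) : W `<=` U ->
  restr W (restr U s) = restr W s.
Proof.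
move=> WU; apply/funext => x; have [Wx|Wx] := pselect (W x).
  by rewrite !restr_in//; exact: WU.
by rewrite !restr_out.
Qed.

Lemma smooth_on_at U f x : open U -> smooth_on U f -> U x -> smooth_at x f.
Proof. by exists U. Qed.

Lemma smooth_on_restr U f : open U -> smooth_on U f -> smooth_on U (restr U f).
Proof. by move=> oU; apply: eq_smooth_on => // x Ux; rewrite restr_in. Qed.

Lemma near_smooth_at x f : smooth_at x f -> \forall y \near x, smooth_at y f.
Proof.
move=> [U [oU Ux fs]]; apply: filterS (open_nbhs_nbhs (conj oU Ux)) => y Uy.
by exists U.
Qed.

Lemma smooth_at_cst m (a : C) : smooth_at m (cst a : func).
Proof. by exists setT; split=> //; [exact: openT|exact: smooth_on_cst]. Qed.

Lemma smooth_at_op2 (op : func -> func -> func) :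
  (forall U f g, open U -> smooth_on U f -> smooth_on U g -> smooth_on U (op f g)) ->
  forall m f g, smooth_at m f -> smooth_at m g -> smooth_at m (op f g).
Proof.
move=> H m f g [U [oU Um fs]] [V [oV Vm gs]]; exists (U `&` V); split=> //.
  exact: openI.
by apply: H; [exact: openI|apply: smooth_on_subset fs; exact: subIsetl
  |apply: smooth_on_subset gs; exact: subIsetr].
Qed.

Lemma smooth_atD m f g : smooth_at m f -> smooth_at m g -> smooth_at m (f + g).
Proof. by apply: smooth_at_op2 => *; exact: smooth_onD. Qed.

Lemma smooth_atB m f g : smooth_at m f -> smooth_at m g -> smooth_at m (f - g).
Proof. by apply: (smooth_at_op2 (op := fun f g => f - g)) => *; exact: smooth_onB. Qed.

Lemma smooth_atM m f g : smooth_at m f -> smooth_at m g -> smooth_at m (f * g).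
Proof. by apply: smooth_at_op2 => *; exact: smooth_onM. Qed.

Lemma smooth_atZ m (a : C) f : smooth_at m f -> smooth_at m (a *: f).
Proof. by move=> [U [oU Um fs]]; exists U; split=> //; exact: smooth_onZ. Qed.

Lemma smooth_at_conj m f : smooth_at m f -> smooth_at m (conj_func f).
Proof. by move=> [U [oU Um fs]]; exists U; split=> //; exact: smooth_on_conj. Qed.

Lemma conj_funcK : involutive (@conj_func R n M).
Proof. by move=> f; apply/funext => x; rewrite /conj_func conjcK. Qed.

Lemma smooth_at_conjE m f : smooth_at m (conj_func f) <-> smooth_at m f.
Proof.
by split=> [/smooth_at_conj|]; [rewrite conj_funcK|exact: smooth_at_conj].
Qed.

Section AtPoint.
Variables (m : M) (D : tvec).
Hypothesis tD : is_tangent m D.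

Lemma tangentD f g : smooth_at m f -> smooth_at m g -> D (f + g) = D f + D g.
Proof.
by move=> fs gs; have := tangent_linear tD 1 fs gs; rewrite scale1r mul1r.
Qed.

Lemma tangent0 : D 0 = 0.
Proof.
have s0 : smooth_at m (0 : func) by exact: smooth_at_cst.
have /eqP := tangentD s0 s0.
by rewrite addr0 -subr_eq0 opprD addrA subrr sub0r oppr_eq0 => /eqP.
Qed.

Lemma tangentZ (a : C) f : smooth_at m f -> D (a *: f) = a * D f.
Proof.
have s0 : smooth_at m (0 : func) by exact: smooth_at_cst.
by move=> fs; have := tangent_linear tD a fs s0; rewrite !addr0 tangent0 addr0.
Qed.

Lemma tangentB f g : smooth_at m f -> smooth_at m g -> D (f - g) = D f - D g.
Proof.
move=> fs gs; rewrite tangentD//; last by rewrite -scaleN1r; exact: smooth_atZ.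
by rewrite -[in LHS]scaleN1r tangentZ// mulN1r.
Qed.

Lemma tangent_cst (a : C) : D (cst a) = 0.
Proof.
have s1 : smooth_at m (1 : func) by exact: smooth_at_cst.
have D1 : D 1 = 0.
  have /eqP := tangent_leibniz tD s1 s1; rewrite mulr1 [1 m]/(1 : C).
  by rewrite mulr1 mul1r -subr_eq0 opprD addrA subrr sub0r oppr_eq0 => /eqP.
rewrite (_ : cst a = a *: (1 : func)); first by rewrite tangentZ// D1 mulr0.
by apply/funext => x; exact/esym/mulr1.
Qed.

End AtPoint.

Lemma is_tangent_comb m (a : C) D D' : is_tangent m D -> is_tangent m D' ->
  is_tangent m (a *: D + D').
Proof.
move=> tD tD'; split=> [b f g fs gs|f g fs gs|f g fs gs fg|f fs].
- rewrite !fctE (tangent_linear tD)// (tangent_linear tD')//.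
  by rewrite [_ *: _]mulrDr [a *: D f]/(a * D f) [a *: D g]/(a * D g);
    rewrite mulrDr !mulrA (mulrC b a) addrACA.
- rewrite !fctE (tangent_leibniz tD)// (tangent_leibniz tD')//.
  rewrite [_ *: _]mulrDr [a *: D f]/(a * D f) [a *: D g]/(a * D g).
  by rewrite mulrDl mulrDr addrACA !mulrA (mulrC (f m) a).
- by rewrite !fctE (tangent_germ tD fs gs fg) (tangent_germ tD' fs gs fg).
- by rewrite !fctE (tangent_junk tD fs) (tangent_junk tD' fs) scaler0 addr0.
Qed.

Lemma is_tangent0 m : is_tangent m 0.
Proof. by split=> // *; rewrite ?mulr0 ?mul0r addr0. Qed.

Lemma is_tangentZ m (a : C) D : is_tangent m D -> is_tangent m (a *: D).
Proof.
move=> tD; rewrite -[_ *: _]addr0.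
by apply: is_tangent_comb => //; exact: is_tangent0.
Qed.

Lemma conjcD (a b : C) : conjc (a + b) = conjc a + conjc b.
Proof. exact: (rmorphD (@conjc R)). Qed.

Lemma conjcB (a b : C) : conjc (a - b) = conjc a - conjc b.
Proof. exact: (rmorphB (@conjc R)). Qed.

Lemma conjcM (a b : C) : conjc (a * b) = conjc a * conjc b.
Proof. exact: (rmorphM (@conjc R)). Qed.

Lemma conj_tvecK : involutive (@conj_tvec R n M).
Proof. by move=> D; apply/funext => f; rewrite /conj_tvec conj_funcK conjcK. Qed.

Lemma conj_funcD f g : conj_func (f + g) = conj_func f + conj_func g.
Proof. by apply/funext => x; exact: conjcD. Qed.

Lemma conj_funcM f g : conj_func (f * g) = conj_func f * conj_func g.
Proof. by apply/funext => x; exact: conjcM. Qed.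

Lemma conj_funcZ (a : C) f : conj_func (a *: f) = conjc a *: conj_func f.
Proof. by apply/funext => x; exact: conjcM. Qed.

(** Both the argument and the value are conjugated, so a scalar is conjugated twice and the operator
    remains complex linear. *)
Lemma is_tangent_conj m D : is_tangent m D -> is_tangent m (conj_tvec D).
Proof.
move=> tD; split=> [b f g fs gs|f g fs gs|f g fs gs fg|f fs]; rewrite /conj_tvec.
- rewrite conj_funcD conj_funcZ (tangent_linear tD) ?smooth_at_conjE//.
  by rewrite conjcD conjcM conjcK.
- rewrite conj_funcM (tangent_leibniz tD) ?smooth_at_conjE//.
  by rewrite conjcD !conjcM /conj_func !conjcK.
- congr conjc; apply: (tangent_germ tD); rewrite ?smooth_at_conjE//.
  by apply: filterS fg => x; rewrite /conj_func => ->.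
- by rewrite (tangent_junk tD) ?smooth_at_conjE// conjc0.
Qed.

Lemma is_tangent_conjE m D : is_tangent m (conj_tvec D) <-> is_tangent m D.
Proof.
by split=> [/is_tangent_conj|]; [rewrite conj_tvecK|exact: is_tangent_conj].
Qed.

Lemma ext_dE U f x D : U x -> is_tangent x D -> ext_d U f x D = D f.
Proof. by move=> Ux tD; rewrite /ext_d restr_in//; case: asboolP. Qed.

Lemma ext_d_eq0 U f x D : ~ is_tangent x D -> ext_d U f x D = 0.
Proof.
move=> tD; have [Ux|Ux] := pselect (U x); last by rewrite /ext_d restr_out.
by rewrite /ext_d restr_in//; case: asboolP.
Qed.

(** Extensionality for differentials: covectors are normalized to 0 off the tangent space, so a
    covector is known once its values on tangent vectors are. The identities for d below are proved
    through it. *)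
Lemma eq_ext_d U f x (xi : cvec) : U x ->
  (forall D, is_tangent x D -> xi D = D f) ->
  (forall D, ~ is_tangent x D -> xi D = 0) -> ext_d U f x = xi.
Proof.
move=> Ux xif xi0; apply/funext => D.
have [tD|tD] := pselect (is_tangent x D); first by rewrite ext_dE ?xif.
by rewrite ext_d_eq0 ?xi0.
Qed.

Lemma is_cotangent_ext_d U f x : U x -> smooth_at x f -> is_cotangent x (ext_d U f x).
Proof.
move=> Ux fs; split=> [a D D' tD tD'|D]; last exact: ext_d_eq0.
by rewrite !ext_dE//; exact: is_tangent_comb.
Qed.

(** The open set in [ext_d] only decides where the form is cut off to 0. Allowing two different sets
    makes it possible to compare the differential of a function with that of its restriction. *)
Lemma ext_d_germ U V f g x : U x -> V x -> smooth_at x f -> smooth_at x g ->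
  (\forall y \near x, f y = g y) -> ext_d U f x = ext_d V g x.
Proof.
move=> Ux Vx fs gs fg; apply: eq_ext_d => // D tD; last exact: ext_d_eq0.
by rewrite ext_dE//; apply/esym/(tangent_germ tD).
Qed.

Lemma ext_d_comb U (a : C) f g x : U x -> smooth_at x f -> smooth_at x g ->
  ext_d U (a *: f + g) x = a *: ext_d U f x + ext_d U g x.
Proof.
move=> Ux fs gs; apply: eq_ext_d => // D tD; rewrite !fctE.
  by rewrite !ext_dE// (tangent_linear tD).
by rewrite !ext_d_eq0// scaler0 addr0.
Qed.

Lemma ext_dM U f g x : U x -> smooth_at x f -> smooth_at x g ->
  ext_d U (f * g) x = f x *: ext_d U g x + g x *: ext_d U f x.
Proof.
move=> Ux fs gs; apply: eq_ext_d => // D tD; rewrite !fctE.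
  by rewrite !ext_dE// (tangent_leibniz tD)// addrC [D f * _]mulrC.
by rewrite !ext_d_eq0// !scaler0 addr0.
Qed.

Lemma ext_d_cst U (a : C) x : U x -> ext_d U (cst a) x = 0.
Proof. by move=> Ux; apply: eq_ext_d => // D tD; rewrite (tangent_cst tD). Qed.

Lemma ext_d_conj U f x : U x -> ext_d U (conj_func f) x = conj_cvec (ext_d U f x).
Proof.
move=> Ux; apply: eq_ext_d => // D tD; rewrite /conj_cvec.
  rewrite ext_dE//; last exact/is_tangent_conjE.
  by rewrite /conj_tvec conjcK.
by rewrite ext_d_eq0 ?conjc0 ?is_tangent_conjE.
Qed.

End Tangent.

(** * Vector fields, the Lie bracket and conjugation *)

Section VectorFields.
Context {R : realType} {n : nat} (M : manifold R n).
Local Notation C := (R[i]^o)%type.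
Local Notation func := (cfunction R M).
Local Notation tvec := (tvector R M).
Local Notation cvec := (covector R M).
Implicit Types (U V : set M) (m x : M) (f g h : func) (D : tvec).
Implicit Types (X Y Z : M -> tvec).

Lemma vector_field_out U X x : vector_field U X -> ~ U x -> X x = 0.
Proof. by move=> [/restr_idP X0 _ _]; exact: X0. Qed.

Lemma vector_field_tangent U X x : vector_field U X -> U x -> is_tangent x (X x).
Proof. by move=> [_ H _]; exact: H. Qed.

Lemma vector_field_smooth U V X f : vector_field U X -> open V -> V `<=` U ->
  smooth_on V f -> smooth_on V (tapply X f).
Proof. by move=> [_ _ H]; exact: H. Qed.

Lemma smooth_at_tapply U X f x : open U -> vector_field U X -> U x ->
  smooth_at x f -> smooth_at x (tapply X f).
Proof.
move=> oU XU Ux [V [oV Vx fs]]; have oUV := openI oU oV.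
exists (U `&` V); split=> //; apply: vector_field_smooth XU _ _ _ => //.
by apply: smooth_on_subset fs; exact: subIsetr.
Qed.

Lemma tapply_germ U X f g x : open U -> vector_field U X -> U x ->
  smooth_at x f -> smooth_at x g -> (\forall y \near x, f y = g y) ->
  \forall y \near x, tapply X f y = tapply X g y.
Proof.
move=> oU XU Ux fs gs fg; near=> y.
apply: (tangent_germ (vector_field_tangent XU _)).
- by near: y; exact: open_nbhs_nbhs.
- by near: y; exact: near_smooth_at.
- by near: y; exact: near_smooth_at.
(* An equality near x is also an equality near each y close to x, as [tangent_germ] requires at
   y. *)
- by near: y; exact: near_join.
Unshelve. all: by end_near. Qed.

Lemma vector_field0 U : vector_field U (0 : M -> tvec).
Proof.
split=> [|x _|V f oV VU fs]; first by apply/restr_idP.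
- exact: is_tangent0.
- exact: smooth_on_cst.
Qed.

Lemma vector_fieldD U X Y : vector_field U X -> vector_field U Y ->
  vector_field U (X + Y).
Proof.
move=> XU YU; split=> [|x Ux|V f oV VU fs].
- apply/restr_idP => x Ux; change (X x + Y x = 0).
  by rewrite (vector_field_out XU Ux) (vector_field_out YU Ux) addr0.
- have := is_tangent_comb 1 (vector_field_tangent XU Ux) (vector_field_tangent YU Ux).
  by rewrite scale1r.
- by apply: (smooth_onD (f := tapply X f) (g := tapply Y f)) => //;
    [exact: vector_field_smooth XU oV VU fs|exact: vector_field_smooth YU oV VU fs].
Qed.

Lemma vector_fieldM U f X : smooth_on U f -> vector_field U X ->
  vector_field U (fun x => f x *: X x).
Proof.
move=> fs XU; split=> [|x Ux|V g oV VU gs].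
- by apply/restr_idP => x Ux; rewrite (vector_field_out XU)// scaler0.
- exact/is_tangentZ/(vector_field_tangent XU).
- apply: (smooth_onM (f := f) (g := tapply X g)) => //.
    exact: smooth_on_subset fs.
  exact: vector_field_smooth XU oV VU gs.
Qed.

Lemma vector_fieldZ U (a : C) X : vector_field U X -> vector_field U (a *: X).
Proof. by apply: vector_fieldM; exact: smooth_on_cst. Qed.

Lemma vector_field_local U X : (forall x, ~ U x -> X x = 0) ->
  (forall x, U x -> exists V Y, [/\ open V, V x, vector_field V Y &
    forall y, V y -> X y = Y y]) -> vector_field U X.
Proof.
move=> X0 XV; split=> [|x /XV[V [Y [oV Vx YV ->//]]]|W f oW WU fs].
- exact/restr_idP.
- exact: vector_field_tangent Vx.
- apply: smooth_on_local => x Wx; have [V [Y [oV Vx YV XY]]] := XV _ (WU _ Wx).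
  have oI := openI oV oW; exists (V `&` W) => //.
  apply: (@eq_smooth_on _ _ _ _ (tapply Y f)) => //.
    by move=> y [Vy _]; rewrite /tapply XY.
  apply: vector_field_smooth YV _ _ _ => //.
  by apply: smooth_on_subset fs; exact: subIsetr.
Qed.

Lemma vector_field_restr U V X : open V -> V `<=` U ->
  vector_field U X -> vector_field V (restr V X).
Proof.
move=> oV VU XU; split=> [|x Vx|W f oW WV fs].
- by rewrite restr_restr.
- by rewrite restr_in//; exact/(vector_field_tangent XU)/VU.
- apply: (@eq_smooth_on _ _ _ _ (tapply X f)) => //.
    by move=> y /WV Vy; rewrite /tapply restr_in.
  by apply: vector_field_smooth XU _ _ _ => //; exact: subset_trans VU.
Qed.

Lemma tapply_restr V X f x : V x -> tapply (restr V X) f x = tapply X f x.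
Proof. by move=> Vx; rewrite /tapply restr_in. Qed.

Lemma lieE X Y x f : smooth_at x f ->
  lie X Y x f = X x (tapply Y f) - Y x (tapply X f).
Proof. by rewrite /lie; case: asboolP. Qed.

Lemma lie_junk X Y x f : ~ smooth_at x f -> lie X Y x f = 0.
Proof. by rewrite /lie; case: asboolP. Qed.

Lemma eq_lie X Y x D : (forall f, smooth_at x f ->
    X x (tapply Y f) - Y x (tapply X f) = D f) ->
  (forall f, ~ smooth_at x f -> D f = 0) -> lie X Y x = D.
Proof.
move=> H H0; apply/funext => f; have [fs|fs] := pselect (smooth_at x f).
  by rewrite lieE// H.
by rewrite lie_junk// H0.
Qed.

Section Lie.
Variables (U : set M) (X Y : M -> tvec).
Hypotheses (oU : open U) (XU : vector_field U X) (YU : vector_field U Y).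

Let tX x (Ux : U x) := vector_field_tangent XU Ux.
Let tY x (Ux : U x) := vector_field_tangent YU Ux.

Lemma near_tapply_comb Z x (a : C) f g : vector_field U Z -> U x ->
  smooth_at x f -> smooth_at x g ->
  \forall y \near x, tapply Z (a *: f + g) y = (a *: tapply Z f + tapply Z g) y.
Proof.
move=> ZU Ux fs gs; near=> y.
rewrite /tapply !fctE (tangent_linear (vector_field_tangent ZU _))//.
- by near: y; exact: open_nbhs_nbhs.
- by near: y; exact: near_smooth_at.
- by near: y; exact: near_smooth_at.
Unshelve. all: by end_near. Qed.

Lemma near_tapplyM Z x f g : vector_field U Z -> U x ->
  smooth_at x f -> smooth_at x g ->
  \forall y \near x, tapply Z (f * g) y = (tapply Z f * g + f * tapply Z g) y.
Proof.
move=> ZU Ux fs gs; near=> y.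
rewrite /tapply !fctE (tangent_leibniz (vector_field_tangent ZU _))//.
- by near: y; exact: open_nbhs_nbhs.
- by near: y; exact: near_smooth_at.
- by near: y; exact: near_smooth_at.
Unshelve. all: by end_near. Qed.

Lemma tangent_tapply_comb D Z x (a : C) f g : is_tangent x D ->
  vector_field U Z -> U x -> smooth_at x f -> smooth_at x g ->
  D (tapply Z (a *: f + g)) = a * D (tapply Z f) + D (tapply Z g).
Proof.
move=> tD ZU Ux fs gs; have sZ h := smooth_at_tapply (f := h) oU ZU Ux.
rewrite (tangent_germ tD _ _ (near_tapply_comb a ZU Ux fs gs)).
- by rewrite (tangent_linear tD)//; exact: sZ.
- by apply: sZ; apply: smooth_atD => //; exact: smooth_atZ.
- by apply: smooth_atD; [apply: smooth_atZ|]; exact: sZ.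
Qed.

(** The two mixed products of first derivatives are exchanged when D and Z swap roles. They cancel
    in the commutator, which is why the Lie bracket is again a derivation. *)
Lemma tangent_tapplyM D Z x f g : is_tangent x D ->
  vector_field U Z -> U x -> smooth_at x f -> smooth_at x g ->
  D (tapply Z (f * g)) = D (tapply Z f) * g x + Z x f * D g +
    (D f * Z x g + f x * D (tapply Z g)).
Proof.
move=> tD ZU Ux fs gs; have sZ h := smooth_at_tapply (f := h) oU ZU Ux.
rewrite (tangent_germ tD _ _ (near_tapplyM ZU Ux fs gs)).
- rewrite (tangentD tD); try by apply: smooth_atM => //; exact: sZ.
  by rewrite !(tangent_leibniz tD)//; exact: sZ.
- by apply: sZ; apply: smooth_atM.
- by apply: smooth_atD; apply: smooth_atM => //; exact: sZ.
Qed.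

Lemma is_tangent_lie x : U x -> is_tangent x (lie X Y x).
Proof.
move=> Ux; have sX h := smooth_at_tapply (f := h) oU XU Ux.
have sY h := smooth_at_tapply (f := h) oU YU Ux.
split=> [b f g fs gs|f g fs gs|f g fs gs fg|f fs].
- have fgs : smooth_at x (b *: f + g) by apply: smooth_atD => //; exact: smooth_atZ.
  rewrite !lieE// (tangent_tapply_comb _ (tX Ux) YU)// (tangent_tapply_comb _ (tY Ux) XU)//.
  by rewrite mulrBr opprD addrACA.
- rewrite !lieE//; last exact: smooth_atM.
  rewrite (tangent_tapplyM (tX Ux) YU)// (tangent_tapplyM (tY Ux) XU)//.
  ring.
- by rewrite !lieE// (tangent_germ (tX Ux) _ _ (tapply_germ oU YU Ux fs gs fg));
    rewrite ?(tangent_germ (tY Ux) _ _ (tapply_germ oU XU Ux fs gs fg));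
    rewrite //; auto.
- exact: lie_junk.
Qed.

Lemma vector_field_lie : vector_field U (lie X Y).
Proof.
split=> [|x Ux|V f oV VU fs].
- apply/restr_idP => x Ux; apply: eq_lie => // f fs.
  by rewrite (vector_field_out XU)// (vector_field_out YU)// subr0.
- exact: is_tangent_lie.
- have sX := vector_field_smooth XU oV VU; have sY := vector_field_smooth YU oV VU.
  apply: (eq_smooth_on oV _ (smooth_onB oV (sX _ (sY _ fs)) (sY _ (sX _ fs)))) => x Vx.
  by rewrite /tapply lieE //; exact: smooth_on_at oV fs Vx.
Qed.

End Lie.

(** Restricting a field changes the function it produces only outside V, and a tangent vector at a
    point of V sees only the germ there. Outside V both sides are 0. *)
Lemma lie_restr U V X Y : open U -> open V -> V `<=` U ->
  vector_field U X -> vector_field U Y ->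
  restr V (lie X Y) = lie (restr V X) (restr V Y).
Proof.
move=> oU oV VU XU YU; apply/esym/funext => x; have [Vx|Vx] := pselect (V x); last first.
  rewrite restr_out//; apply: eq_lie => // f _; by rewrite !restr_out// subr0.
have Ux := VU _ Vx.
rewrite restr_in//; apply: eq_lie => f fs; last exact: lie_junk.
have H Z : vector_field U Z -> forall D, is_tangent x D ->
    D (tapply (restr V Z) f) = D (tapply Z f).
  move=> ZU D tD; apply: (tangent_germ tD).
  - exact: (smooth_at_tapply oV (vector_field_restr oV VU ZU)).
  - exact: (smooth_at_tapply oU ZU).
  - by apply: filterS (open_nbhs_nbhs (conj oV Vx)) => y Vy; exact: tapply_restr.
rewrite lieE// !restr_in// !H//.
  exact: vector_field_tangent Ux.
exact: vector_field_tangent Ux.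
Qed.

Definition conj_field X : M -> tvec := fun x => conj_tvec (X x).

Lemma tapply_conj X f : tapply (conj_field X) f = conj_func (tapply X (conj_func f)).
Proof. by []. Qed.

Lemma vector_field_conj U X : vector_field U X -> vector_field U (conj_field X).
Proof.
move=> XU; split=> [|x Ux|V f oV VU fs].
- apply/restr_idP => x Ux; rewrite /conj_field (vector_field_out XU)//.
  by apply/funext => f; exact: conjc0.
- exact/is_tangent_conj/(vector_field_tangent XU).
- rewrite tapply_conj; apply: smooth_on_conj => //.
  by apply: vector_field_smooth XU _ _ _ => //; exact: smooth_on_conj.
Qed.

(** In a composite of two conjugated fields the inner conjugations cancel. This carries brackets
    between E and its conjugate. *)
Lemma lie_conj X Y : lie (conj_field X) (conj_field Y) = conj_field (lie X Y).
Proof.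
apply/funext => x; apply: eq_lie => f fs; last first.
  by rewrite /conj_field /conj_tvec lie_junk ?conjc0 ?smooth_at_conjE.
rewrite !tapply_conj /conj_field /conj_tvec !conj_funcK lieE ?smooth_at_conjE//.
by rewrite -conjcB.
Qed.

Lemma one_form_ext_d U f : smooth_on U f -> open U -> one_form U (ext_d U f).
Proof.
move=> fs oU; split=> [|x Ux|V X oV VU XV].
- by rewrite /ext_d restr_restr.
- exact: is_cotangent_ext_d (smooth_on_at oU fs Ux).
- apply: (@eq_smooth_on _ _ _ _ (tapply X f)) => //.
    move=> x Vx; rewrite /Defs.contract ext_dE//; first exact: VU.
    exact: vector_field_tangent Vx.
  by apply: vector_field_smooth XV _ _ _ => //; exact: smooth_on_subset fs.
Qed.

End VectorFields.

(** * The Courant sheaf *)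

Section CourantSheaf.
Context {R : realType} {n : nat} (M : manifold R n).
Local Notation C := (R[i]^o)%type.
Local Notation func := (cfunction R M).
Local Notation tvec := (tvector R M).
Local Notation cvec := (covector R M).
Local Notation gvec := (gvector R M).
Local Notation sect := (func * (M -> tvec))%type.
Implicit Types (U V : set M) (m x : M) (f g h : func) (D : tvec).
Implicit Types (X Y Z : M -> tvec) (s t u : sect).

Lemma conj_cvecK : involutive (@conj_cvec R n M).
Proof. by move=> xi; apply/funext => D; rewrite /conj_cvec conj_tvecK conjcK. Qed.

Section ConjBundle.
Variables (E : M -> set gvec) (m : M).

Lemma conj_bundleP (p : gvec) :
  conj_bundle E m p <-> E m (conj_tvec p.1, conj_cvec p.2).
Proof.
split=> [[q Eq <-] /=|Ep]; first by rewrite conj_tvecK conj_cvecK; case: q Eq.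
by exists (conj_tvec p.1, conj_cvec p.2) => //=; rewrite conj_tvecK conj_cvecK; case: p Ep.
Qed.

Lemma conj_bundle_subspace : is_subspace (E m) -> is_subspace (conj_bundle E m).
Proof.
move=> [E0 EZ]; split=> [|a p q /conj_bundleP Ep /conj_bundleP Eq]; apply/conj_bundleP.
  by congr (E m (_, _)) : E0; apply/funext => ?; apply/esym/conjc0.
(* Conjugation is antilinear, so the scalar a on the conjugate side corresponds to [conjc a] in the
   fibre of E. *)
have := EZ (conjc a) _ _ Ep Eq; congr (E m (_, _)); apply/funext => D /=.
  change (conjc a * conjc (p.1 (conj_func D)) + conjc (q.1 (conj_func D)) =
    conjc (a * p.1 (conj_func D) + q.1 (conj_func D))).
  by rewrite conjcD conjcM.
change (conjc a * conjc (p.2 (conj_tvec D)) + conjc (q.2 (conj_tvec D)) =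
  conjc (a * p.2 (conj_tvec D) + q.2 (conj_tvec D))).
by rewrite conjcD conjcM.
Qed.

(** The pairing of two conjugates is the conjugate of the pairing, and the factor - 1/2 can be
    cancelled. *)
Lemma conj_bundle_isotropic (p q : gvec) : isotropic (E m) ->
  conj_bundle E m p -> conj_bundle E m q -> p.2 q.1 + q.2 p.1 = 0.
Proof.
move=> iE /conj_bundleP Ep /conj_bundleP Eq; have /eqP := iE _ _ Ep Eq.
rewrite mulf_eq0 oppr_eq0 invr_eq0 pnatr_eq0 /= /conj_cvec !conj_tvecK -conjcD.
by rewrite conjc_eq0 => /eqP.
Qed.

End ConjBundle.

(** The differential of a smooth function is automatically a smooth 1-form, so beyond the smoothness
    of the two components only a pointwise membership in the conjugate bundle remains. *)
Lemma COUP (E : M -> set gvec) U s : open U -> COU E U s <->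
  [/\ smooth_on U s.1, forall x, ~ U x -> s.1 x = 0, vector_field U s.2 &
      forall x, U x -> conj_bundle E x (s.2 x, ext_d U s.1 x)].
Proof.
move=> oU; split=> [[[fs /restr_idP f0] XU [_ EX]]|[fs /restr_idP f0 XU EX]]; split=> //.
by split=> //; split=> //; exact: one_form_ext_d.
Qed.

Lemma sect_ext s t : (forall x, s.1 x = t.1 x) -> (forall x f, s.2 x f = t.2 x f) -> s = t.
Proof.
case: s t => [f X] [g Y] /= fg XY; congr pair; first exact/funext.
by apply/funext => x; apply/funext.
Qed.

Variable E : M -> set gvec.
Hypothesis subE : forall m, is_subspace (E m).

Lemma COU_comb U (a : C) s t : open U -> COU E U s -> COU E U t ->
  COU E U (a *: s + t).
Proof.
move=> oU /(COUP _ _ oU)[fs f0 XU EX] /(COUP _ _ oU)[gs g0 YU EY].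
apply/(COUP _ _ oU); split=> [|x Ux| |x Ux].
- by apply: (smooth_onD (f := a *: s.1)) => //; exact: smooth_onZ.
- change (a * s.1 x + t.1 x = 0); by rewrite f0// g0// mulr0 addr0.
- by apply: (vector_fieldD (X := a *: s.2)) => //; exact: vector_fieldZ.
- change (a *: s + t).1 with (a *: s.1 + t.1).
  rewrite (ext_d_comb a Ux (smooth_on_at oU fs Ux) (smooth_on_at oU gs Ux)).
  have [_ cl] := conj_bundle_subspace (subE x).
  exact: (cl a _ _ (EX x Ux) (EY x Ux)).
Qed.

(** Provides both the zero section (a = 0) and the unit (a = 1). The restricted constant is not
    constant on M, so its differential is computed through the germ. *)
Lemma COU_cst U (a : C) : open U -> COU E U (restr U (cst a), 0).
Proof.
move=> oU; have as_ : smooth_on U (cst a : func) by exact: smooth_on_cst.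
apply/(COUP _ _ oU); split=> /= [|x Ux| |x Ux].
- exact: smooth_on_restr.
- exact: restr_out.
- exact: vector_field0.
- rewrite (@ext_d_germ _ _ _ _ U _ (cst a))//; last first.
  + by apply: filterS (open_nbhs_nbhs (conj oU Ux)) => y Uy; rewrite restr_in.
  + exact: smooth_at_cst.
  + exact: smooth_on_at oU (smooth_on_restr oU as_) Ux.
  by rewrite ext_d_cst//; have [] := conj_bundle_subspace (subE x).
Qed.

Lemma COU0 U : open U -> COU E U 0.
Proof.
move=> oU; have := COU_cst 0 oU; congr (COU E U _); congr pair.
exact/restr_idP.
Qed.

Lemma COUZ U (a : C) s : open U -> COU E U s -> COU E U (a *: s).
Proof. by move=> oU sU; rewrite -[_ *: _]addr0; apply: COU_comb => //; exact: COU0. Qed.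

Lemma COUD U s t : open U -> COU E U s -> COU E U t -> COU E U (s + t).
Proof. by move=> oU sU tU; rewrite -[s]scale1r; exact: COU_comb. Qed.

Lemma COUM U s t : open U -> COU E U s -> COU E U t -> COU E U (cou_mul s t).
Proof.
move=> oU /(COUP _ _ oU)[fs f0 XU EX] /(COUP _ _ oU)[gs g0 YU EY].
apply/(COUP _ _ oU); split=> [|x Ux| |x Ux].
- exact: smooth_onM.
- by change (s.1 x * t.1 x = 0); rewrite f0// mul0r.
- apply: (vector_fieldD (X := fun x => s.1 x *: t.2 x) (Y := fun x => t.1 x *: s.2 x));
    exact: vector_fieldM.
- rewrite /= (ext_dM Ux (smooth_on_at oU fs Ux) (smooth_on_at oU gs Ux)).
  have [z cl] := conj_bundle_subspace (subE x).
  (* At x the product corresponds to f (Y, dg) + g (X, df), built by two uses of the subspace law,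
     the inner one with summand 0. *)
  have := cl (t.1 x) _ _ (EX x Ux) z; rewrite addr0.
  exact: (cl (s.1 x) _ _ (EY x Ux)).
Qed.

Lemma COU_out U s x : COU E U s -> ~ U x -> s.1 x = 0 /\ s.2 x = 0.
Proof. by move=> [[_ /restr_idP s1] [/restr_idP s2 _ _] _] Ux; rewrite s1 ?s2. Qed.

Lemma COU_res U V s : open U -> open V -> V `<=` U -> COU E U s ->
  COU E V (cou_res V s).
Proof.
move=> oU oV VU /(COUP _ _ oU)[fs f0 XU EX].
have fV := smooth_on_subset VU fs; have rV := smooth_on_restr oV fV.
apply/(COUP _ _ oV); split=> /= [|x Vx| |x Vx].
- exact: rV.
- exact: restr_out.
- exact: vector_field_restr XU.
- have Ux := VU _ Vx; rewrite restr_in// (@ext_d_germ _ _ _ _ U _ s.1)//.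
  + exact: EX.
  + exact: smooth_on_at oV rV Vx.
  + exact: smooth_on_at oV fV Vx.
  + by apply: filterS (open_nbhs_nbhs (conj oV Vx)) => y Vy; rewrite restr_in.
Qed.

Lemma COU_local U s : open U -> (forall x, ~ U x -> s.1 x = 0 /\ s.2 x = 0) ->
  (forall x, U x -> exists V, [/\ open V, V x, V `<=` U & COU E V (cou_res V s)]) ->
  COU E U s.
Proof.
move=> oU s0 sV; apply/(COUP _ _ oU); split=> [|x /s0[]//| |x Ux].
- apply: smooth_on_local => x /sV[V [oV Vx VU /(COUP _ _ oV)[fs _ _ _]]].
  by exists V => //; apply: eq_smooth_on fs => // y Vy; rewrite /= restr_in.
- apply: vector_field_local => [x /s0[]//|x /sV[V [oV Vx VU /(COUP _ _ oV)[_ _ XV _]]]].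
  by exists V, (restr V s.2); split=> // y Vy; rewrite restr_in.
- have [V [oV Vx VU /(COUP _ _ oV)[fs _ _ /(_ x Vx)/=]]] := sV x Ux.
  rewrite restr_in// => EX.
  rewrite (@ext_d_germ _ _ _ _ V _ (restr V s.1))//.
  + apply: (smooth_on_at oV _ Vx).
    by apply: eq_smooth_on fs => // y Vy; rewrite /= restr_in.
  + exact: smooth_on_at oV fs Vx.
  + by apply: filterS (open_nbhs_nbhs (conj oV Vx)) => y Vy; rewrite restr_in.
Qed.

Lemma cou_resE V s t : (forall x, V x -> s.1 x = t.1 x /\ s.2 x = t.2 x) <->
  cou_res V s = cou_res V t.
Proof.
split=> [st|[e1 e2] x Vx].
  by congr pair; apply/funext => x; (have [Vx|Vx] := pselect (V x);
    [rewrite !restr_in//; case: (st x Vx)|rewrite !restr_out]).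
by rewrite -(restr_in s.1 Vx) -(restr_in s.2 Vx) e1 e2 !restr_in.
Qed.

Lemma COU_eq U s t : COU E U s -> COU E U t -> cou_res U s = cou_res U t -> s = t.
Proof.
move=> sU tU /cou_resE st; apply: sect_ext => x => [|f];
  (have [Ux|Ux] := pselect (U x);
    first by have [e1 e2] := st x Ux; rewrite ?e1 ?e2);
  by have [e1 e2] := COU_out sU Ux; have [e3 e4] := COU_out tU Ux;
    rewrite ?e1 ?e2 ?e3 ?e4.
Qed.

Lemma COU_glue (I : Type) (V : I -> set M) (s : I -> sect) :
  (forall i, open (V i)) -> (forall i, COU E (V i) (s i)) ->
  (forall i j, cou_res (V i `&` V j) (s i) = cou_res (V i `&` V j) (s j)) ->
  exists! t, COU E (\bigcup_i V i) t /\ forall i, cou_res (V i) t = s i.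
Proof.
move=> oV sV sE; have oW : open (\bigcup_i V i) by exact: bigcup_open.
(* At each point of the union a value is chosen from some member of the cover; agreement on overlaps
   makes the choice irrelevant ([tE]). The default 0 off the union is what the encoding of sections
   requires. *)
pose W x := pselect (exists i, V i x).
pose t : sect := (fun x => if W x is left h then (s (projT1 (cid h))).1 x else 0,
                  fun x => if W x is left h then (s (projT1 (cid h))).2 x else 0).
have tE i x : V i x -> t.1 x = (s i).1 x /\ t.2 x = (s i).2 x.
  move=> Vx; rewrite /t /=; case: (W x) => [h|]; last by case; exists i.
  by case: cid => j Vj /=; have /cou_resE := sE j i; apply.
have tV i : cou_res (V i) t = s i.
  apply: (COU_eq (U := V i)) => //; last first.
    by apply/cou_resE => x Vx; rewrite /= !restr_in//; exact: tE.
  rewrite (_ : cou_res _ _ = cou_res (V i) (s i)); last by apply/cou_resE; exact: tE.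
  exact: COU_res (oV i) (oV i) (@subset_refl _ _) (sV i).
have tW : COU E (\bigcup_i V i) t.
  apply: COU_local => // [x Wx|x [i _ Vx]].
    by rewrite /t /=; case: (W x) => // -[i Vx]; case: Wx; exists i.
  by exists (V i); split=> //; [exact: bigcup_sup|rewrite tV].
exists t; split=> // t' [t'W t'V]; apply: COU_eq tW t'W _.
apply/cou_resE => x [i _ Vx].
by have /cou_resE : cou_res (V i) t = cou_res (V i) t' by [rewrite tV t'V]; apply.
Qed.

Lemma COU_sheaf : is_sheaf (COU E) (@cou_res R n M).
Proof.
split=> [U V s|U s _ [[_ f0] [X0 _ _] _]|U V W s _ _ _ WV _ _|];
  [exact: COU_res| | |exact: COU_glue].
  by rewrite /cou_res f0 X0 -surjective_pairing.
by rewrite /cou_res /= !restr_restr.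
Qed.

Lemma COU_comm_algebra U : open U -> is_comm_algebra (COU E U) (@cou_ops R n M U).
Proof.
move=> oU; split.
- exact: COU0.
- exact: COU_cst.
- by move=> s t; exact: COUD.
- by move=> s sU /=; rewrite -scaleN1r; exact: COUZ.
- by move=> s t; exact: COUM.
- by move=> a s; exact: COUZ.
- by move=> s t u _ _ _ /=; exact: addrA.
- by move=> s t _ _ /=; exact: addrC.
- by move=> s _ /=; exact: add0r.
- by move=> s _ /=; exact: addNr.
- move=> s t u _ _ _; apply: sect_ext => [x|x f]; first exact: mulrA.
  change (s.1 x * (t.1 x * u.2 x f + u.1 x * t.2 x f) + t.1 x * u.1 x * s.2 x f =
    s.1 x * t.1 x * u.2 x f + u.1 x * (s.1 x * t.2 x f + t.1 x * s.2 x f)).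
  ring.
- move=> s t _ _; apply: sect_ext => [x|x f]; first exact: mulrC.
  exact: addrC.
- move=> s sU; apply: sect_ext => [x|x f];
    have [Ux|Ux] := pselect (U x).
  + by change (restr U 1 x * s.1 x = s.1 x); rewrite restr_in// mul1r.
  + by change (restr U 1 x * s.1 x = s.1 x); rewrite restr_out// mul0r (COU_out sU Ux).1.
  + change (restr U 1 x * s.2 x f + s.1 x * 0 = s.2 x f).
    by rewrite restr_in// mul1r mulr0 addr0.
  + change (restr U 1 x * s.2 x f + s.1 x * 0 = s.2 x f).
    by rewrite restr_out// (COU_out sU Ux).2 mul0r mulr0 addr0.
- move=> s t u _ _ _; apply: sect_ext => [x|x f]; first exact: mulrDl.
  change ((s.1 x + t.1 x) * u.2 x f + u.1 x * (s.2 x f + t.2 x f) =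
    (s.1 x * u.2 x f + u.1 x * s.2 x f) + (t.1 x * u.2 x f + u.1 x * t.2 x f)).
  ring.
- by move=> s _; exact: scale1r.
- by move=> a b s _; exact: scalerA.
- by move=> a s t _ _; exact: scalerDr.
- by move=> a b s _; exact: scalerDl.
- move=> a s t _ _; apply: sect_ext => [x|x f]; first exact: mulrA.
  change (a * (s.1 x * t.2 x f + t.1 x * s.2 x f) =
    a * s.1 x * t.2 x f + t.1 x * (a * s.2 x f)).
  ring.
Qed.

Lemma restr_op {A B D : zmodType} (op : A -> B -> D) V (s : M -> A) (t : M -> B) :
  op 0 0 = 0 ->
  restr V (fun x => op (s x) (t x)) = fun x => op (restr V s x) (restr V t x).
Proof.
move=> op0; apply/funext => x; have [Vx|Vx] := pselect (V x).
  by rewrite !restr_in.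
by rewrite !restr_out.
Qed.

Lemma COU_sheaf_of_comm_algebras :
  is_sheaf_of_comm_algebras (COU E) (@cou_res R n M) (@cou_ops R n M).
Proof.
split; [exact: COU_sheaf|exact: COU_comm_algebra|move=> U V _ _ VU|
  move=> U V s t _ _ _ _ _|move=> U V s t _ _ _ _ _|move=> U V a s _ _ _ _].
- by rewrite /cou_res /= restr_restr//; congr pair; exact/restr_idP.
- change ((restr V (fun x => s.1 x + t.1 x), restr V (fun x => s.2 x + t.2 x)) =
    (fun x => restr V s.1 x + restr V t.1 x, fun x => restr V s.2 x + restr V t.2 x)).
  by rewrite !restr_op ?addr0.
- apply: sect_ext => [x|x f]; have [Vx|Vx] := pselect (V x).
  + change (restr V (s.1 * t.1) x = restr V s.1 x * restr V t.1 x).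
    by rewrite !restr_in.
  + change (restr V (s.1 * t.1) x = restr V s.1 x * restr V t.1 x).
    by rewrite !restr_out// mul0r.
  + change (restr V (cou_mul s t).2 x f =
      restr V s.1 x * restr V t.2 x f + restr V t.1 x * restr V s.2 x f).
    by rewrite !restr_in.
  + change (restr V (cou_mul s t).2 x f =
      restr V s.1 x * restr V t.2 x f + restr V t.1 x * restr V s.2 x f).
    by rewrite !(restr_out _ Vx) !mul0r addr0.
- apply: sect_ext => [x|x f]; have [Vx|Vx] := pselect (V x).
  + change (restr V (a *: s.1) x = a * restr V s.1 x).
    by rewrite !restr_in.
  + change (restr V (a *: s.1) x = a * restr V s.1 x).
    by rewrite !restr_out// mulr0.
  + change (restr V (a *: s.2) x f = a * restr V s.2 x f).
    by rewrite !restr_in.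
  + change (restr V (a *: s.2) x f = a * restr V s.2 x f).
    by rewrite !restr_out// mulr0.
Qed.

End CourantSheaf.

(** * Stalks *)

Section StalkAlgebra.
Context {K : pzRingType} {T : topologicalType} {S : Type}.
Variables (F : set T -> set S) (res : set T -> S -> S).
Variables (o : set T -> alg_ops K S) (m : T).
Hypothesis shF : is_sheaf_of_comm_algebras F res o.

Local Notation local := (local_section F m).
Local Notation germ := (germ F res m).
Local Notation stalk := (stalk F res m).

Let shv := algsheaf_sheaf shF.
Let alg U (oU : open U) := algsheaf_alg shF oU.

(** Restriction is assumed to respect only the unit, sums, products and scalars. By additivity the
    image r of zero satisfies r + r = r, and cancellation gives r = 0. *)
Lemma sheaf_algebra_res0 U V : open U -> open V -> V `<=` U ->
  res V (azero (o U)) = azero (o V).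
Proof.
move=> oU oV VU; have aU := alg oU; have aV := alg oV.
have zU := alg_zero_in aU; have rV := sheaf_res shv oU oV VU zU.
have := algsheaf_res_add shF oU oV VU zU zU; rewrite (alg_add0 aU)// => e.
have := alg_addN aV rV; rewrite {2}e (alg_addA aV)//; last exact: alg_opp_in.
by rewrite (alg_addN aV)// (alg_add0 aV).
Qed.

Lemma sheaf_algebra_resN U V s : open U -> open V -> V `<=` U -> F U s ->
  res V (aopp (o U) s) = aopp (o V) (res V s).
Proof.
move=> oU oV VU sU; have aU := alg oU; have aV := alg oV.
have nU := alg_opp_in aU sU; have nV := sheaf_res shv oU oV VU nU.
have sV := sheaf_res shv oU oV VU sU; have nsV := alg_opp_in aV sV.
have := alg_addN aU sU => /(congr1 (res V)).
rewrite (algsheaf_res_add shF)// sheaf_algebra_res0// => e.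
rewrite -(alg_add0 aV nV) -(alg_addN aV sV) -(alg_addA aV)//.
by rewrite (alg_addC aV sV nV) e (alg_addC aV nsV (alg_zero_in aV)) (alg_add0 aV).
Qed.

(** A germ is a set of local sections, so this amounts to transitivity of agreement near m: on the
    intersection of two neighbourhoods of agreement all the restrictions coincide. Exchanging p and
    q gives the other inclusion. *)
Lemma germ_eqP p q : local p -> local q -> germ p = germ q <->
  exists W, [/\ open W, W m, W `<=` p.1 `&` q.1 & res W p.2 = res W q.2].
Proof.
move=> [op pm Fp] [oq qm Fq]; split=> [pq|].
  have [] : germ p q by rewrite pq; split=> //; exists q.1.
  by move=> _ [W ?]; exists W.
have H p' q' : local p' -> local q' ->
    (exists W, [/\ open W, W m, W `<=` p'.1 `&` q'.1 & res W p'.2 = res W q'.2]) ->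
    germ p' `<=` germ q'.
  move=> [op' pm' Fp'] [oq' qm' Fq'] [W [oW Wm WI e]] r [[or rm Fr] [W' [oW' Wm' WI' e']]].
  split=> //; exists (W `&` W'); have oWW := openI oW oW'; split=> //.
    by move=> x [/WI[_ ?] /WI'[_ ?]].
  have sub1 : W `<=` p'.1 by move=> x /WI[].
  have sub2 : W `<=` q'.1 by move=> x /WI[].
  have sub3 : W' `<=` p'.1 by move=> x /WI'[].
  have sub4 : W' `<=` r.1 by move=> x /WI'[].
  rewrite -(sheaf_res_res shv oq' oW oWW (@subIsetl _ _ _) sub2 Fq') -e.
  rewrite (sheaf_res_res shv op' oW oWW (@subIsetl _ _ _) sub1 Fp').
  rewrite -(sheaf_res_res shv op' oW' oWW (@subIsetr _ _ _) sub3 Fp') e'.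
  by rewrite (sheaf_res_res shv or oW' oWW (@subIsetr _ _ _) sub4 Fr).
move=> [W [oW Wm WI e]]; apply/seteqP; split; apply: H => //; exists W; split=> //.
by rewrite setIC.
Qed.

Lemma germ_self p : local p -> germ p p.
Proof. by move=> [op pm Fp]; split=> //; exists p.1; split. Qed.

Lemma mem_germ p q : local p -> germ p q -> local q /\ germ q = germ p.
Proof.
by move=> lp [lq H]; split=> //; apply/esym/(germ_eqP lp lq).
Qed.

Lemma local_res W p : local p -> open W -> W m -> W `<=` p.1 -> local (W, res W p.2).
Proof. by move=> [op pm Fp] oW Wm Wp; split=> //=; exact: (sheaf_res shv op). Qed.

Lemma germ_res W p : local p -> open W -> W m -> W `<=` p.1 ->
  germ (W, res W p.2) = germ p.
Proof.
move=> lp oW Wm Wp; apply/germ_eqP => //; first exact: local_res.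
have [op pm Fp] := lp; exists W; split=> //=; first by move=> x; split=> //; exact: Wp.
by rewrite (sheaf_res_res shv op).
Qed.

Section Unary.
Variable op1 : set T -> S -> S.
Hypothesis op1_in : forall U s, open U -> F U s -> F U (op1 U s).
Hypothesis op1_res : forall U V s, open U -> open V -> V `<=` U -> F U s ->
  res V (op1 U s) = op1 V (res V s).

(** [germ_map] is a union over all representatives. An operation that commutes with restriction
    sends them all to one germ, so the union collapses to it. *)
Lemma germ_mapE U s : local (U, s) ->
  germ_map F res m op1 (germ (U, s)) = germ (U, op1 U s).
Proof.
move=> ls; have [/= oU Um sU] := ls.
have H p : germ (U, s) p -> germ (p.1, op1 p.1 p.2) = germ (U, op1 U s).
  move=> ps; have [[op pm Fp] e] := mem_germ ls ps.
  case: ps => _ /= [W [oW Wm WI /= es]].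
  apply/germ_eqP; [by split=> //; exact: op1_in|by split=> //; exact: op1_in|].
  exists W; split=> //=; first by rewrite setIC.
  have W1 : W `<=` p.1 by move=> x /WI[].
  have W2 : W `<=` U by move=> x /WI[].
  by rewrite !op1_res// es.
apply/seteqP; split=> [q [p ps]|q qs]; first by rewrite H.
by exists (U, s); [exact: germ_self|].
Qed.

End Unary.

Section Binary.
Variable op2 : set T -> S -> S -> S.
Hypothesis op2_in : forall U s t, open U -> F U s -> F U t -> F U (op2 U s t).
Hypothesis op2_res : forall U V s t, open U -> open V -> V `<=` U ->
  F U s -> F U t -> res V (op2 U s t) = op2 V (res V s) (res V t).

(** As in the unary case, except that the two representatives may have different domains. The
    operation is formed on their intersection and compared with the one over U where both agreements
    hold. *)
Lemma germ_map2E U s t : local (U, s) -> local (U, t) ->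
  germ_map2 F res m op2 (germ (U, s)) (germ (U, t)) = germ (U, op2 U s t).
Proof.
move=> ls lt; have [/= oU Um sU] := ls; have [_ _ /= tU] := lt.
have H p q : germ (U, s) p -> germ (U, t) q ->
    germ (p.1 `&` q.1, op2 (p.1 `&` q.1) (res (p.1 `&` q.1) p.2) (res (p.1 `&` q.1) q.2)) =
    germ (U, op2 U s t).
  move=> ps qt; have [lp _] := mem_germ ls ps; have [lq _] := mem_germ lt qt.
  have [op pm Fp] := lp; have [oq qm Fq] := lq.
  case: ps => _ /= [W [oW Wm WI /= es]]; case: qt => _ /= [W' [oW' Wm' WI' /= et]].
  have oI := openI op oq; have oWW := openI oW oW'.
  have F1 : F (p.1 `&` q.1) (res (p.1 `&` q.1) p.2).
    by apply: (sheaf_res shv op oI) => // x [].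
  have F2 : F (p.1 `&` q.1) (res (p.1 `&` q.1) q.2).
    by apply: (sheaf_res shv oq oI) => // x [].
  apply/germ_eqP; [by split=> //=; exact: op2_in|by split=> //=; exact: op2_in|].
  exists (W `&` W'); split=> //=.
    by move=> x [/WI[Ux px] /WI'[_ qx]].
  have W1 : W `&` W' `<=` p.1 `&` q.1 by move=> x [/WI[_ ?] /WI'[_ ?]].
  have W2 : W `&` W' `<=` U by move=> x [/WI[? _] _].
  have W3 : W `<=` U by move=> x /WI[].
  have W4 : W' `<=` U by move=> x /WI'[].
  have W5 : W `<=` p.1 by move=> x /WI[].
  have W6 : W' `<=` q.1 by move=> x /WI'[].
  rewrite !op2_res// (sheaf_res_res shv op oI oWW)// (sheaf_res_res shv oq oI oWW)//.
  rewrite -(sheaf_res_res shv op oW oWW _ W5 Fp)// -es.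
  rewrite -(sheaf_res_res shv oq oW' oWW _ W6 Fq)// -et.
  by rewrite (sheaf_res_res shv oU oW oWW)// (sheaf_res_res shv oU oW' oWW).
apply/seteqP; split=> [r [p ps [q qt br]]|r rs]; first by rewrite -(H p q).
exists (U, s); first exact: germ_self.
exists (U, t); first exact: germ_self.
by move: rs; rewrite -(H (U, s) (U, t))//; exact: germ_self.
Qed.

End Binary.

Lemma stalk_addE U s t : local (U, s) -> local (U, t) ->
  aadd (stalk_ops F res o m) (germ (U, s)) (germ (U, t)) = germ (U, aadd (o U) s t).
Proof.
apply: germ_map2E => [V s' t' oV|V W s' t'].
  exact: (alg_add_in (alg oV)).
exact: (algsheaf_res_add shF).
Qed.

Lemma stalk_mulE U s t : local (U, s) -> local (U, t) ->
  amul (stalk_ops F res o m) (germ (U, s)) (germ (U, t)) = germ (U, amul (o U) s t).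
Proof.
apply: germ_map2E => [V s' t' oV|V W s' t'].
  exact: (alg_mul_in (alg oV)).
exact: (algsheaf_res_mul shF).
Qed.

Lemma stalk_oppE U s : local (U, s) ->
  aopp (stalk_ops F res o m) (germ (U, s)) = germ (U, aopp (o U) s).
Proof.
apply: germ_mapE => [V s' oV|V W s']; last exact: sheaf_algebra_resN.
exact: (alg_opp_in (alg oV)).
Qed.

Lemma stalk_scaleE a U s : local (U, s) ->
  ascale (stalk_ops F res o m) a (germ (U, s)) = germ (U, ascale (o U) a s).
Proof.
apply: (germ_mapE (op1 := fun V => ascale (o V) a)) => [V s' oV|V W s'].
  exact: (alg_scale_in (alg oV)).
exact: (algsheaf_res_scale shF).
Qed.

(** The zero of the stalk is a global germ; here it is moved to the domain of the other
    representatives in a law. *)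
Lemma stalk_zeroE U : open U -> U m ->
  azero (stalk_ops F res o m) = germ (U, azero (o U)).
Proof.
move=> oU Um; rewrite -(sheaf_algebra_res0 openT oU (@subsetT _ _)).
rewrite (germ_res (p := (setT, azero (o setT))))//.
by split=> //; [exact: openT|exact: alg_zero_in (alg openT)].
Qed.

Lemma stalk_oneE U : open U -> U m ->
  aone (stalk_ops F res o m) = germ (U, aone (o U)).
Proof.
move=> oU Um; rewrite -(algsheaf_res_one shF openT oU (@subsetT _ _)).
rewrite (germ_res (p := (setT, aone (o setT))))//.
by split=> //; [exact: openT|exact: alg_one_in (alg openT)].
Qed.

Lemma stalk_rep g : stalk g -> exists U s, local (U, s) /\ g = germ (U, s).
Proof. by move=> [[U s] ls <-]; exists U, s. Qed.

(** On a common domain the laws of the algebra of sections apply directly, and each law of the stalk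
    reduces to one of them. *)
Lemma stalk_rep2 g h : stalk g -> stalk h -> exists U s t,
  [/\ local (U, s), local (U, t), g = germ (U, s) & h = germ (U, t)].
Proof.
move=> [p lp <-] [q lq <-]; have [op pm Fp] := lp; have [oq qm Fq] := lq.
have oI := openI op oq.
have lI : (p.1 `&` q.1) m by [].
exists (p.1 `&` q.1), (res (p.1 `&` q.1) p.2), (res (p.1 `&` q.1) q.2).
split; [exact: local_res|exact: local_res|rewrite germ_res//|rewrite germ_res//].
Qed.

Lemma stalk_rep3 g h k : stalk g -> stalk h -> stalk k -> exists U s t u,
  [/\ local (U, s), local (U, t) & local (U, u)] /\
  [/\ g = germ (U, s), h = germ (U, t) & k = germ (U, u)].
Proof.
move=> sg sh [p lp <-]; have [U [s [t [ls lt -> ->]]]] := stalk_rep2 sg sh.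
have [op pm Fp] := lp; have [/= oU Um Fs] := ls.
have oI := openI oU op; have lI : (U `&` p.1) m by [].
have sub : U `&` p.1 `<=` U by exact: subIsetl.
exists (U `&` p.1), (res (U `&` p.1) s), (res (U `&` p.1) t), (res (U `&` p.1) p.2).
split; split; by [exact: (local_res ls)|exact: (local_res lt)|exact: local_res|
  rewrite (germ_res ls)|rewrite (germ_res lt)|rewrite germ_res].
Qed.

Lemma stalk_germ p : local p -> stalk (germ p).
Proof. by exists p. Qed.

Lemma stalk_comm_algebra : is_comm_algebra stalk (stalk_ops F res o m).
Proof.
have loc U s : open U -> U m -> F U s -> local (U, s) by [].
have aT := alg openT.
split.
- by apply: stalk_germ; apply: loc; [exact: openT| |exact: alg_zero_in].
- by apply: stalk_germ; apply: loc; [exact: openT| |exact: alg_one_in].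
- move=> g h sg sh; have [U [s [t [ls lt -> ->]]]] := stalk_rep2 sg sh.
  rewrite stalk_addE//; apply: stalk_germ.
  by case: ls lt => [/= oU Um Fs] [_ _ /= Ft]; split=> //=; exact: (alg_add_in (alg oU)).
- move=> g sg; have [U [s [ls ->]]] := stalk_rep sg.
  rewrite stalk_oppE//; apply: stalk_germ.
  by case: ls => [/= oU Um Fs]; split=> //=; exact: (alg_opp_in (alg oU)).
- move=> g h sg sh; have [U [s [t [ls lt -> ->]]]] := stalk_rep2 sg sh.
  rewrite stalk_mulE//; apply: stalk_germ.
  by case: ls lt => [/= oU Um Fs] [_ _ /= Ft]; split=> //=; exact: (alg_mul_in (alg oU)).
- move=> a g sg; have [U [s [ls ->]]] := stalk_rep sg.
  rewrite stalk_scaleE//; apply: stalk_germ.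
  by case: ls => [/= oU Um Fs]; split=> //=; exact: (alg_scale_in (alg oU)).
- move=> g h k sg sh sk.
  have [U [s [t [u [[ls lt lu] [-> -> ->]]]]]] := stalk_rep3 sg sh sk.
  have [oU Um Fs] : [/\ open U, U m & F U s] := ls; have Ft : F U t by case: lt.
  have Fu : F U u by case: lu.
  have aU := alg oU; have i := alg_add_in aU.
  have l1 : local (U, aadd (o U) s t) by apply: loc => //; exact: i _ _ Fs Ft.
  have l2 : local (U, aadd (o U) t u) by apply: loc => //; exact: i _ _ Ft Fu.
  by rewrite (stalk_addE lt lu) (stalk_addE ls l2) (stalk_addE ls lt)
    (stalk_addE l1 lu) (alg_addA aU).
- move=> g h sg sh; have [U [s [t [ls lt -> ->]]]] := stalk_rep2 sg sh.
  have [oU Um Fs] : [/\ open U, U m & F U s] := ls; have Ft : F U t by case: lt.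
  by rewrite !stalk_addE// (alg_addC (alg oU)).
- move=> g sg; have [U [s [ls ->]]] := stalk_rep sg.
  have [oU Um Fs] : [/\ open U, U m & F U s] := ls.
  have zU := alg_zero_in (alg oU).
  by rewrite (stalk_zeroE oU Um) stalk_addE// (alg_add0 (alg oU)).
- move=> g sg; have [U [s [ls ->]]] := stalk_rep sg.
  have [oU Um Fs] : [/\ open U, U m & F U s] := ls.
  have nU := alg_opp_in (alg oU) Fs.
  by rewrite (stalk_zeroE oU Um) stalk_oppE// stalk_addE// (alg_addN (alg oU)).
- move=> g h k sg sh sk.
  have [U [s [t [u [[ls lt lu] [-> -> ->]]]]]] := stalk_rep3 sg sh sk.
  have [oU Um Fs] : [/\ open U, U m & F U s] := ls; have Ft : F U t by case: lt.
  have Fu : F U u by case: lu.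
  have aU := alg oU; have i := alg_mul_in aU.
  have l1 : local (U, amul (o U) s t) by apply: loc => //; exact: i _ _ Fs Ft.
  have l2 : local (U, amul (o U) t u) by apply: loc => //; exact: i _ _ Ft Fu.
  by rewrite (stalk_mulE lt lu) (stalk_mulE ls l2) (stalk_mulE ls lt)
    (stalk_mulE l1 lu) (alg_mulA aU).
- move=> g h sg sh; have [U [s [t [ls lt -> ->]]]] := stalk_rep2 sg sh.
  have [oU Um Fs] : [/\ open U, U m & F U s] := ls; have Ft : F U t by case: lt.
  by rewrite !stalk_mulE// (alg_mulC (alg oU)).
- move=> g sg; have [U [s [ls ->]]] := stalk_rep sg.
  have [oU Um Fs] : [/\ open U, U m & F U s] := ls.
  have zU := alg_one_in (alg oU).
  by rewrite (stalk_oneE oU Um) stalk_mulE// (alg_mul1 (alg oU)).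
- move=> g h k sg sh sk.
  have [U [s [t [u [[ls lt lu] [-> -> ->]]]]]] := stalk_rep3 sg sh sk.
  have [oU Um Fs] : [/\ open U, U m & F U s] := ls; have Ft : F U t by case: lt.
  have Fu : F U u by case: lu.
  have aU := alg oU; have i := alg_mul_in aU; have j := alg_add_in aU.
  have l1 : local (U, aadd (o U) s t) by apply: loc => //; exact: j _ _ Fs Ft.
  have l2 : local (U, amul (o U) s u) by apply: loc => //; exact: i _ _ Fs Fu.
  have l3 : local (U, amul (o U) t u) by apply: loc => //; exact: i _ _ Ft Fu.
  by rewrite stalk_addE// !stalk_mulE// stalk_addE// (alg_mulD aU).
- move=> g sg; have [U [s [ls ->]]] := stalk_rep sg.
  have [oU Um Fs] : [/\ open U, U m & F U s] := ls.
  by rewrite stalk_scaleE// (alg_scale1 (alg oU)).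
- move=> a b g sg; have [U [s [ls ->]]] := stalk_rep sg.
  have [oU Um Fs] : [/\ open U, U m & F U s] := ls.
  have bU := alg_scale_in (alg oU) b Fs.
  by rewrite !stalk_scaleE// (alg_scaleA (alg oU)).
- move=> a g h sg sh; have [U [s [t [ls lt -> ->]]]] := stalk_rep2 sg sh.
  have [oU Um Fs] : [/\ open U, U m & F U s] := ls; have Ft : F U t by case: lt.
  have aU := alg oU.
  have l1 : local (U, aadd (o U) s t) by apply: loc => //; exact: (alg_add_in aU).
  have l2 : local (U, ascale (o U) a s) by apply: loc => //; exact: (alg_scale_in aU).
  have l3 : local (U, ascale (o U) a t) by apply: loc => //; exact: (alg_scale_in aU).
  by rewrite stalk_addE// !stalk_scaleE// stalk_addE// (alg_scaleDr aU).
- move=> a b g sg; have [U [s [ls ->]]] := stalk_rep sg.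
  have [oU Um Fs] : [/\ open U, U m & F U s] := ls.
  have aU := alg_scale_in (alg oU) a Fs; have bU := alg_scale_in (alg oU) b Fs.
  by rewrite !stalk_scaleE// stalk_addE// (alg_scaleDl (alg oU)).
- move=> a g h sg sh; have [U [s [t [ls lt -> ->]]]] := stalk_rep2 sg sh.
  have [oU Um Fs] : [/\ open U, U m & F U s] := ls; have Ft : F U t by case: lt.
  have aU := alg oU.
  have l1 : local (U, amul (o U) s t) by apply: loc => //; exact: (alg_mul_in aU).
  have l2 : local (U, ascale (o U) a s) by apply: loc => //; exact: (alg_scale_in aU).
  by rewrite stalk_mulE// !stalk_scaleE// stalk_mulE// (alg_scaleM aU).
Qed.

End StalkAlgebra.

(** A proper ideal contains no unit and therefore lies inside I. Thus I is the largest proper ideal,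
    which yields its maximality and its uniqueness at once. *)
Lemma local_ring_units {K : pzRingType} {S : Type} (A : set S) (o : alg_ops K S)
    (I : set S) : is_comm_algebra A o -> is_ideal A o I -> ~ I (aone o) ->
  (forall s, A s -> ~ I s -> exists2 t, A t & amul o t s = aone o) ->
  is_local_ring_with A o I.
Proof.
move=> aA iI I1 inv.
have noU J : is_ideal A o J -> J <> A -> J `<=` I.
  move=> iJ JA s Js; apply: contrapT => Is; apply: JA.
  have [t At ts] := inv s (ideal_sub iJ Js) Is.
  apply/seteqP; split=> [|u Au]; first exact: ideal_sub iJ.
  have J1 : J (aone o) by rewrite -ts; exact: (ideal_mul iJ).
  rewrite -(alg_mul1 aA Au) (alg_mulC aA (alg_one_in aA) Au).
  exact: (ideal_mul iJ).
have IA : I <> A by move=> e; apply: I1; rewrite e; exact: alg_one_in aA.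
split=> // [|J [iJ JA maxJ]].
  by split=> // J iJ IJ JA; apply/seteqP; split=> //; exact: noU.
exact/esym/(maxJ I iI (noU J iJ JA) IA).
Qed.

(** * Units and the maximal ideal in the stalks of the Courant sheaf *)

Section CourantStalk.
Context {R : realType} {n : nat} (M : manifold R n).
Local Notation C := (R[i]^o)%type.
Local Notation func := (cfunction R M).
Local Notation tvec := (tvector R M).
Local Notation gvec := (gvector R M).
Variable E : M -> set gvec.
Hypothesis subE : forall m, is_subspace (E m).

Local Notation COU := (COU E).
Local Notation res := (@cou_res R n M).
Local Notation ops := (@cou_ops R n M).

Let shC := COU_sheaf_of_comm_algebras subE.

(** Sections with the same germ agree on a set containing m, so the value at m does not depend on
    the representative. *)
Lemma vanishing_germP m p : local_section COU m p ->
  vanishing_germs E m (germ COU res m p) <-> p.2.1 m = 0.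
Proof.
move=> lp; split=> [[q [lq q0] e]|p0]; last by exists p.
have [W [oW Wm WI /cou_resE/(_ m Wm)[e1 _]]] := (germ_eqP shC lq lp).1 e.
by rewrite -e1.
Qed.

Lemma COU_inv U s m : open U -> COU U s -> U m -> s.1 m != 0 ->
  exists W t, [/\ open W, W m, W `<=` U, COU W t &
    cou_mul t (res W s) = aone (ops W)].
Proof.
move=> oU sU Um fm; have [fs f0 XU EX] := (COUP E s oU).1 sU.
pose W := [set x | U x /\ s.1 x != 0].
have oW : open W.
  rewrite openE => x [Ux fx].
  exact: filterI (open_nbhs_nbhs (conj oU Ux)) (smooth_on_near_neq0 oU fs Ux fx).
have WU : W `<=` U by move=> x [].
pose g : func := fun x => (s.1 x)^-1.
have fW := smooth_on_subset WU fs.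
have gs : smooth_on W g by apply: smooth_onV => // x [].
have XW := vector_field_restr oW WU XU.
pose h : func := - (g * g).
have hs : smooth_on W h by apply: smooth_onN => //; exact: smooth_onM.
pose t := (restr W g, fun x => h x *: restr W s.2 x).
have tW : COU W t.
  apply/(COUP _ _ oW); split=> /= [|x Wx| |x Wx].
  - exact: smooth_on_restr.
  - exact: restr_out.
  - exact: vector_fieldM.
  - have [_ cl] := conj_bundle_subspace (subE x); have [Ux fx] := Wx.
    (* With h = - 1/f^2, the vector h (X, df) lies in the fibre; it remains to identify h df with
       d(1/f). *)
    have := cl (h x) _ _ (EX x Ux) (conj_bundle_subspace (subE x)).1.
    rewrite addr0 restr_in//; congr (conj_bundle E x (_, _)).
    have fx_s := smooth_on_at oW fW Wx; have gx_s := smooth_on_at oW gs Wx.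
    apply/esym/eq_ext_d => // D tD; last first.
      by change (h x * ext_d U s.1 x D = 0); rewrite ext_d_eq0// mulr0.
    change (h x * ext_d U s.1 x D = D (restr W g)).
    rewrite ext_dE// (tangent_germ (f := restr W g) tD _ gx_s); last first.
    + by apply: filterS (open_nbhs_nbhs (conj oW Wx)) => y Wy; rewrite restr_in.
    + exact: smooth_on_at oW (smooth_on_restr oW gs) Wx.
    (* The function f (1/f) is 1 near x, so a tangent vector kills it; solving the Leibniz rule for
       D(1/f) replaces a quotient rule. *)
    have : D (s.1 * g) = 0.
      rewrite (tangent_germ tD (g := cst 1)) ?(tangent_cst tD)//.
      + exact: smooth_atM.
      + exact: smooth_at_cst.
      + apply: filterS (open_nbhs_nbhs (conj oW Wx)) => y [_ fy].
        exact: mulfV.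
    rewrite (tangent_leibniz tD)// => /eqP; rewrite addr_eq0 => /eqP e.
    have -> : D g = g x * (s.1 x * D g) by rewrite mulrA mulVf ?mul1r.
    by rewrite -[s.1 x * _]opprK -e; change (h x) with (- (g x * g x)); ring.
exists W, t; split=> //; apply: sect_ext => [x|x k].
  change (restr W g x * restr W s.1 x = restr W 1 x).
  have [Wx|Wx] := pselect (W x); last by rewrite !restr_out// mul0r.
  by rewrite !restr_in//; apply: mulVf; case: Wx.
change (restr W g x * restr W s.2 x k + restr W s.1 x * (h x * restr W s.2 x k) = 0).
have [Wx|Wx] := pselect (W x); last by rewrite !(restr_out _ Wx) !mul0r addr0.
rewrite !restr_in// mulrA; have [_ fx] := Wx.
have -> : s.1 x * h x = - g x.
  by change (s.1 x * - (g x * g x) = - g x); rewrite mulrN mulrA mulfV// mul1r.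
by rewrite mulNr subrr.
Qed.

Lemma COU_stalk_local m : is_local_ring_with (stalk COU res m)
  (stalk_ops COU res ops m) (vanishing_germs E m).
Proof.
have sT := @openT M.
have VS g : vanishing_germs E m g -> exists U s,
    [/\ local_section COU m (U, s), s.1 m = 0 & g = germ COU res m (U, s)].
  by move=> [[U s] [ls s0] <-]; exists U, s.
apply: local_ring_units.
- exact: (stalk_comm_algebra m shC).
- split=> [g /VS[U [s [ls _ ->]]]|| g h Vg Vh|g h sg Vh].
  + exact: stalk_germ.
  + by apply/vanishing_germP => //; split=> //; exact: COU0.
  + have sg : stalk COU res m g by case: Vg => p [lp _] <-; exact: stalk_germ.
    have sh : stalk COU res m h by case: Vh => p [lp _] <-; exact: stalk_germ.
    have [U [s [t [ls lt eg eh]]]] := stalk_rep2 shC sg sh.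
    move: Vg Vh; rewrite eg eh => /(vanishing_germP ls) s0 /(vanishing_germP lt) t0.
    rewrite (stalk_addE shC ls lt); apply/vanishing_germP.
      by case: ls lt => [/= oU Um Fs] [_ _ Ft]; split=> //; exact: COUD.
    by change (s.1 m + t.1 m = 0); rewrite s0 t0 addr0.
  + have sh : stalk COU res m h by case: Vh => p [lp _] <-; exact: stalk_germ.
    have [U [s [t [ls lt eg eh]]]] := stalk_rep2 shC sg sh.
    move: Vh; rewrite eg eh => /(vanishing_germP lt) t0.
    rewrite (stalk_mulE shC ls lt); apply/vanishing_germP.
      by case: ls lt => [/= oU Um Fs] [_ _ Ft]; split=> //; exact: COUM.
    by change (s.1 m * t.1 m = 0); rewrite t0 mulr0.
- rewrite (stalk_oneE shC sT)// => /vanishing_germP.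
  rewrite /= restr_in// => H; have /eqP := oner_neq0 C; apply; apply: H.
  by split=> //; exact: COU_cst.
- move=> g /stalk_rep[U [s [ls ->]]] /(vanishing_germP ls)/eqP s0.
  have [oU Um Fs] : [/\ open U, U m & COU U s] := ls.
  have [W [t [oW Wm WU tW e]]] := COU_inv oU Fs Um s0.
  have lt : local_section COU m (W, t) by [].
  exists (germ COU res m (W, t)); first exact: stalk_germ.
  rewrite -(germ_res shC ls oW Wm WU) (stalk_mulE shC)//.
    by rewrite (stalk_oneE shC oW Wm) -e.
  exact: (local_res shC ls).
Qed.

End CourantStalk.

(** * The Poisson bracket *)

Section Poisson.
Context {R : realType} {n : nat} (M : manifold R n).
Local Notation C := (R[i]^o)%type.
Local Notation func := (cfunction R M).
Local Notation tvec := (tvector R M).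
Local Notation gvec := (gvector R M).
Local Notation sect := (func * (M -> tvec))%type.
Implicit Types (U V : set M) (x : M) (f g h : func) (D : tvec).
Implicit Types (X Y Z : M -> tvec) (s t u : sect).

(** On a local field W both sides equal W(X(g)), because X(W(g)) - [X, W](g) = W(X(g)). *)
Lemma is_lie_derivative_ext_d U X g : open U -> vector_field U X ->
  smooth_on U g -> is_lie_derivative U X (ext_d U g) (ext_d U (tapply X g)).
Proof.
move=> oU XU gs; have Xgs := vector_field_smooth XU oU (@subset_refl _ _) gs.
split=> [|V W oV VU WV x Vx]; first exact: one_form_ext_d.
have Ux := VU _ Vx; have gx := smooth_on_at oU gs Ux.
have XV := vector_field_restr oV VU XU.
have tX := vector_field_tangent XU Ux; have tW := vector_field_tangent WV Vx.
(* X lives over U and W only over V; tangency of their bracket is available on a common domain, so X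
   is restricted to V first. *)
have tL : is_tangent x (lie X W x).
  suff -> : lie X W x = lie (restr V X) W x by exact: is_tangent_lie oV XV WV x Vx.
  apply: eq_lie => f fs; last by rewrite lie_junk.
  rewrite lieE// restr_in//; congr (_ - _); apply: (tangent_germ tW).
  - exact: (smooth_at_tapply oU XU).
  - exact: (smooth_at_tapply oV XV).
  - by apply: filterS (open_nbhs_nbhs (conj oV Vx)) => y Vy; rewrite tapply_restr.
have Wg : smooth_at x (tapply W g) by exact: (smooth_at_tapply oV WV).
have near_Wg : \forall y \near x, Defs.contract W (ext_d U g) y = tapply W g y.
  apply: filterS (open_nbhs_nbhs (conj oV Vx)) => y Vy.
  by rewrite /Defs.contract ext_dE//; [exact: VU|exact: vector_field_tangent WV Vy].
have Wc : smooth_at x (Defs.contract W (ext_d U g)).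
  exists V; split=> //; have [_ _] := one_form_ext_d gs oU; exact.
rewrite !ext_dE// (tangent_germ tX Wc Wg near_Wg) lieE//.
by rewrite opprB addrC subrK.
Qed.

Variable E : M -> set gvec.
Hypothesis subE : forall m, is_subspace (E m).
Hypothesis isoE : forall m, isotropic (E m).
Local Notation COU := (COU E).

Lemma COU_isotropic U s t : COU U s -> COU U t ->
  tapply t.2 s.1 = - tapply s.2 t.1.
Proof.
move=> sU tU; apply/funext => x; have [Ux|Ux] := pselect (U x); last first.
  change (t.2 x s.1 = - s.2 x t.1).
  by rewrite (COU_out sU Ux).2 (COU_out tU Ux).2; exact/esym/oppr0.
have [_ XU [_ EX]] := sU; have [_ YU [_ EY]] := tU.
have := conj_bundle_isotropic (@isoE x) (EX x Ux) (EY x Ux).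
rewrite /= !ext_dE//; try exact: vector_field_tangent Ux.
by move/eqP; rewrite addr_eq0 => /eqP.
Qed.

(** This form makes the function component a single derivative, so nested brackets can be computed
    without factors 1/2. *)
Lemma cou_bracketE U s t : COU U s -> COU U t ->
  cou_bracket s t = (tapply s.2 t.1, lie s.2 t.2).
Proof.
move=> sU tU; congr pair; rewrite (COU_isotropic sU tU) opprK.
apply/funext => x; change (2^-1 * (s.2 x t.1 + s.2 x t.1) = s.2 x t.1).
by field.
Qed.

(** * Closure under the bracket and the Poisson laws *)

Section Bracket.
Hypothesis intE : integrable_structure E.

(** Integrability concerns E, whereas the Courant sheaf is defined by the conjugate bundle;
    conjugated sections are the ones that can enter the Courant bracket. *)
Lemma COU_conj_section U s : open U -> COU U s ->
  bundle_section E U (fun x => (conj_field s.2 x, ext_d U (conj_func s.1) x)).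
Proof.
move=> oU /(COUP _ _ oU)[fs f0 XU EX]; split.
  by split; [exact: vector_field_conj|apply: one_form_ext_d => //; exact: smooth_on_conj].
by move=> x Ux; have /conj_bundleP := EX x Ux; rewrite ext_d_conj.
Qed.

Lemma COU_bracket U s t : open U -> COU U s -> COU U t -> COU U (cou_bracket s t).
Proof.
move=> oU sU tU; have [fs f0 XU EX] := (COUP E s oU).1 sU.
have [gs g0 YU EY] := (COUP E t oU).1 tU.
have UU := @subset_refl _ U.
have fc := smooth_on_conj oU fs; have gc := smooth_on_conj oU gs.
have XcU := vector_field_conj XU; have YcU := vector_field_conj YU.
set fb := conj_func s.1 in fc *; set gb := conj_func t.1 in gc *.
set Xb := conj_field s.2 in XcU *; set Yb := conj_field t.2 in YcU *.
have XYs := vector_field_smooth XU oU UU gs.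
have YXs := vector_field_smooth YU oU UU fs.
have XYcs := vector_field_smooth XcU oU UU gc.
have YXcs := vector_field_smooth YcU oU UU fc.
pose h : func := 2^-1 *: (tapply s.2 t.1 - tapply t.2 s.1).
have hs : smooth_on U h by apply: smooth_onZ => //; exact: smooth_onB.
(* The factor 1/2 is real, so the conjugate of the function component is the same expression in the
   conjugated data. *)
have hc : conj_func h = 2^-1 *: (tapply Xb gb - tapply Yb fb).
  apply/funext => x; rewrite !tapply_conj !conj_funcK.
  change (conjc (2^-1 * (s.2 x t.1 - t.2 x s.1)) =
    2^-1 * (conjc (s.2 x t.1) - conjc (t.2 x s.1))).
  rewrite conjcM conjcB; congr (_ * _).
  by rewrite (fmorphV (@conjc R)) (rmorph_nat (@conjc R)).
pose b x := (lie Xb Yb x, ext_d U (tapply Xb gb) x - ext_d U (tapply Yb fb) x +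
  2^-1 *: ext_d U (Defs.contract Yb (ext_d U fb) - Defs.contract Xb (ext_d U gb)) x).
have bE : bundle_section E U b.
  apply: (intE oU (COU_conj_section oU sU) (COU_conj_section oU tU)).
  by exists (ext_d U (tapply Xb gb)), (ext_d U (tapply Yb fb)); split=> //;
    exact: is_lie_derivative_ext_d.
apply/(COUP _ _ oU); split=> [|x Ux| |x Ux].
- exact: hs.
- change (2^-1 * (s.2 x t.1 - t.2 x s.1) = 0).
  rewrite (COU_out sU Ux).2 (COU_out tU Ux).2.
  change (2^-1 * (0 - 0) = 0 :> C).
  by rewrite subrr mulr0.
- exact: vector_field_lie.
- apply/conj_bundleP; have [_ /(_ x Ux)] := bE; congr (E x (_, _)).
    by rewrite lie_conj.
  rewrite -ext_d_conj// hc; apply/esym/eq_ext_d => // D tD; last first.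
    change (ext_d U (tapply Xb gb) x D - ext_d U (tapply Yb fb) x D +
      2^-1 * ext_d U (Defs.contract Yb (ext_d U fb) - Defs.contract Xb (ext_d U gb)) x D = 0).
    by rewrite !ext_d_eq0// subrr mulr0 addr0.
  change (ext_d U (tapply Xb gb) x D - ext_d U (tapply Yb fb) x D +
    2^-1 * ext_d U (Defs.contract Yb (ext_d U fb) - Defs.contract Xb (ext_d U gb)) x D =
    D (2^-1 *: (tapply Xb gb - tapply Yb fb))).
  have XYx := smooth_on_at oU XYcs Ux; have YXx := smooth_on_at oU YXcs Ux.
  have cE Z k : vector_field U Z -> smooth_on U k ->
      forall y, U y -> Defs.contract Z (ext_d U k) y = tapply Z k y.
    move=> ZU ks y Uy; rewrite /Defs.contract ext_dE//.
    exact: vector_field_tangent ZU Uy.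
  (* The contractions are derivatives of [fb] and [gb] only on U, so they are replaced under D
     through the germ at x. *)
  have -> : ext_d U (Defs.contract Yb (ext_d U fb) - Defs.contract Xb (ext_d U gb)) x D =
      D (tapply Yb fb - tapply Xb gb).
    have e y : U y -> (Defs.contract Yb (ext_d U fb) - Defs.contract Xb (ext_d U gb)) y =
        (tapply Yb fb - tapply Xb gb) y.
      by move=> Uy; rewrite !fctE !cE.
    have ss := smooth_onB oU YXcs XYcs.
    rewrite ext_dE//; apply: (tangent_germ tD).
    + apply: (smooth_on_at oU _ Ux); apply: eq_smooth_on ss => // y Uy.
      by rewrite e.
    + exact: smooth_atB.
    + exact: filterS (open_nbhs_nbhs (conj oU Ux)).
  rewrite !ext_dE// (tangentZ tD); last exact: smooth_atB.
  (* With P and Q the values of D on X(g) and Y(f), conjugated throughout, P - Q + (Q - P)/2 = (P -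
     Q)/2. This is the origin of the 1/2 in the bracket. *)
  rewrite !(tangentB tD)//; set F := D _; set G := D _.
  by field.
Qed.

Lemma COU_poisson_algebra U : open U ->
  is_poisson_algebra (COU U) (@cou_ops R n M U) (@cou_bracket R n M).
Proof.
move=> oU; have smooth s x : COU U s -> U x -> smooth_at x s.1.
  by move=> /(COUP _ _ oU)[fs _ _ _]; exact: smooth_on_at.
have tgt s x : COU U s -> U x -> is_tangent x (s.2 x).
  by move=> /(COUP _ _ oU)[_ _ XU _]; exact: vector_field_tangent.
have vf s : COU U s -> vector_field U s.2 by move=> /(COUP _ _ oU)[].
have sat s f x : COU U s -> U x -> smooth_at x f -> smooth_at x (tapply s.2 f).
  by move=> sU; apply: smooth_at_tapply; [|exact: vf].
have anti s t : cou_bracket s t = - cou_bracket t s.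
  apply: sect_ext => [x|x f].
    change (2^-1 * (s.2 x t.1 - t.2 x s.1) = - (2^-1 * (t.2 x s.1 - s.2 x t.1))).
    by rewrite -mulrN opprB.
  change (lie s.2 t.2 x f = - lie t.2 s.2 x f).
  have [fs|fs] := pselect (smooth_at x f); last by rewrite !lie_junk// oppr0.
  by rewrite !lieE// opprB.
have cl s t := @COU_bracket U s t oU.
split=> [|s t|a s t u sU tU uU|s sU|s t sU tU|s t u sU tU uU|s t u sU tU uU].
- exact: COU_comm_algebra.
- exact: COU_bracket.
- have su := COU_comb subE a oU sU tU.
  rewrite /= (cou_bracketE su uU) (cou_bracketE sU uU) (cou_bracketE tU uU).
  (* The function component, now of the form X(h), is linear in X by definition; only the field
     component remains. *)
  apply: sect_ext => // x f.
  change (lie (a *: s.2 + t.2) u.2 x f = a * lie s.2 u.2 x f + lie t.2 u.2 x f).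
  have [fs|fs] := pselect (smooth_at x f); last by rewrite !lie_junk// mulr0 addr0.
  have [Ux|Ux] := pselect (U x); last first.
    rewrite !lieE// !(COU_out sU Ux).2 !(COU_out tU Ux).2 !(COU_out uU Ux).2.
    change (a * s.2 x (tapply u.2 f) + t.2 x (tapply u.2 f) - 0 = a * (0 - 0) + (0 - 0) :> C).
    rewrite !(COU_out sU Ux).2 !(COU_out tU Ux).2.
    change (a * 0 + 0 - 0 = a * (0 - 0) + (0 - 0) :> C); ring.
  rewrite !lieE//.
  change (a * s.2 x (tapply u.2 f) + t.2 x (tapply u.2 f) -
      u.2 x (a *: tapply s.2 f + tapply t.2 f) =
    a * (s.2 x (tapply u.2 f) - u.2 x (tapply s.2 f)) +
    (t.2 x (tapply u.2 f) - u.2 x (tapply t.2 f))).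
  rewrite (tangent_linear (tgt _ _ uU Ux)); try exact: sat.
  ring.
- apply: sect_ext => [x|x f].
    change (2^-1 * (s.2 x s.1 - s.2 x s.1) = 0); by rewrite subrr mulr0.
  change (lie s.2 s.2 x f = 0).
  have [fs|fs] := pselect (smooth_at x f); last by rewrite lie_junk.
  by rewrite lieE// subrr.
- exact: anti.
- have stU := cl s t sU tU; have tuU := cl t u tU uU; have usU := cl u s uU sU.
  rewrite /= (cou_bracketE sU tuU) (cou_bracketE tU usU) (cou_bracketE uU stU).
  (* Write s = (f, X), t = (g, Y), u = (h, Z). Isotropy of u against the bracket of s and t reads
     [X, Y](h) = - Z(X(g)). *)
  have := COU_isotropic uU stU.
  move: stU tuU usU; rewrite (cou_bracketE sU tU) (cou_bracketE tU uU) (cou_bracketE uU sU) /=.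
  move=> stU tuU usU e; apply: sect_ext => [x|x f].
    change (s.2 x (tapply t.2 u.1) + (t.2 x (tapply u.2 s.1) + u.2 x (tapply s.2 t.1)) = 0).
    have [Ux|Ux] := pselect (U x); last first.
      rewrite (COU_out sU Ux).2 (COU_out tU Ux).2 (COU_out uU Ux).2.
      change (0 + (0 + 0) = 0 :> C); ring.
    have us := smooth _ _ uU Ux.
    have : lie s.2 t.2 x u.1 = - u.2 x (tapply s.2 t.1).
      by rewrite -[LHS]/(tapply (lie s.2 t.2) u.1 x) e.
    (* Isotropy of s and u gives Z(f) = - X(h), so Y(Z(f)) = - Y(X(h)) completes X(Y(h)) to
       [X, Y](h), which cancels Z(X(g)). *)
    rewrite lieE// (COU_isotropic sU uU) => e'.
    have -> : t.2 x (- tapply s.2 u.1) = - t.2 x (tapply s.2 u.1).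
      rewrite -scaleN1r (tangentZ (tgt _ _ tU Ux)) ?mulN1r//; exact: sat.
    by rewrite addrA e' addNr.
  change (lie s.2 (lie t.2 u.2) x f +
    (lie t.2 (lie u.2 s.2) x f + lie u.2 (lie s.2 t.2) x f) = 0).
  have [fs|fs] := pselect (smooth_at x f); last by rewrite !lie_junk// !addr0.
  have [Ux|Ux] := pselect (U x); last first.
    have z s1 s2 s3 : COU U s1 -> COU U s2 -> COU U s3 ->
        lie s1.2 (lie s2.2 s3.2) x f = 0.
      move=> U1 U2 U3; have V := vector_field_lie oU (vf _ U2) (vf _ U3).
      rewrite lieE// (vector_field_out (vf _ U1) Ux) (vector_field_out V Ux).
      by change (0 - 0 = 0 :> C); rewrite subrr.
    by rewrite !z// !addr0.
  (* Each nested bracket expands into four third-order terms, and the twelve terms of the cyclic sum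
     cancel in pairs. The inner bracket is expanded at all points near x, where f is still
     smooth. *)
  have L s1 s2 s3 : COU U s1 -> COU U s2 -> COU U s3 ->
      lie s1.2 (lie s2.2 s3.2) x f =
      s1.2 x (tapply s2.2 (tapply s3.2 f)) - s1.2 x (tapply s3.2 (tapply s2.2 f))
      - (s2.2 x (tapply s3.2 (tapply s1.2 f)) - s3.2 x (tapply s2.2 (tapply s1.2 f))).
    move=> U1 U2 U3; rewrite lieE// lieE; last exact: sat.
    congr (_ - _); rewrite -(tangentB (tgt _ _ U1 Ux)); try by apply: (sat) => //; exact: sat.
    apply: (tangent_germ (tgt _ _ U1 Ux)).
    - exact: (smooth_at_tapply oU (vector_field_lie oU (vf _ U2) (vf _ U3))).
    - by apply: smooth_atB; apply: (sat) => //; exact: sat.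
    - by apply: filterS (near_smooth_at fs) => y fy; rewrite /tapply lieE.
  rewrite !L//; ring.
- have tuU := COUM subE oU tU uU; rewrite /= (cou_bracketE sU tuU).
  rewrite (cou_bracketE sU tU) (cou_bracketE sU uU).
  apply: sect_ext => [x|x f].
    change (s.2 x (t.1 * u.1) = s.2 x t.1 * u.1 x + t.1 x * s.2 x u.1).
    have [Ux|Ux] := pselect (U x).
      apply: (tangent_leibniz (tgt _ _ sU Ux)); exact: smooth.
    rewrite (COU_out sU Ux).2; change (0 = 0 * u.1 x + t.1 x * 0 :> C); ring.
  change (lie s.2 (cou_mul t u).2 x f =
    (s.2 x t.1 * u.2 x f + u.1 x * lie s.2 t.2 x f) +
    (t.1 x * lie s.2 u.2 x f + s.2 x u.1 * t.2 x f)).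
  have [fs|fs] := pselect (smooth_at x f); last first.
    have [Ux|Ux] := pselect (U x).
      rewrite !lie_junk// !(tangent_junk _ fs) ?mulr0 ?addr0//; exact: tgt.
    rewrite !lie_junk// (COU_out uU Ux).2 (COU_out tU Ux).2.
    change (0 = s.2 x t.1 * 0 + u.1 x * 0 + (t.1 x * 0 + s.2 x u.1 * 0) :> C); ring.
  have [Ux|Ux] := pselect (U x); last first.
    rewrite !lieE// !(COU_out sU Ux).2 !(COU_out tU Ux).2 !(COU_out uU Ux).2.
    rewrite (COU_out tuU Ux).2.
    change (0 - 0 = 0 * 0 + u.1 x * (0 - 0) + (t.1 x * (0 - 0) + 0 * 0) :> C); ring.
  rewrite !lieE//.
  (* For s = (., X), t = (g, Y), u = (h, Z): [X, gZ + hY] = X(g) Z + g [X, Z] + X(h) Y + h [X, Y].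
     The coefficients X(g) and X(h), produced by differentiating g and h, are the function
     components of the brackets of s with t and with u. *)
  change (s.2 x (t.1 * tapply u.2 f + u.1 * tapply t.2 f) -
      (t.1 x * u.2 x (tapply s.2 f) + u.1 x * t.2 x (tapply s.2 f)) =
    (s.2 x t.1 * u.2 x f + u.1 x * (s.2 x (tapply t.2 f) - t.2 x (tapply s.2 f))) +
    (t.1 x * (s.2 x (tapply u.2 f) - u.2 x (tapply s.2 f)) + s.2 x u.1 * t.2 x f)).
  have tS := tgt _ _ sU Ux; have tu := sat _ _ _ uU Ux fs; have tt := sat _ _ _ tU Ux fs.
  have t1 := smooth _ _ tU Ux; have u1 := smooth _ _ uU Ux.
  rewrite (tangentD tS); try exact: smooth_atM.
  rewrite !(tangent_leibniz tS)// /tapply; ring.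
Qed.

Lemma COU_bracket_res U V s t : open U -> open V -> V `<=` U -> COU U s ->
  COU U t -> cou_res V (cou_bracket s t) = cou_bracket (cou_res V s) (cou_res V t).
Proof.
move=> oU oV VU sU tU; have [fs f0 XU _] := (COUP E s oU).1 sU.
have [gs g0 YU _] := (COUP E t oU).1 tU.
have sV := COU_res oU oV VU sU; have tV := COU_res oU oV VU tU.
rewrite (cou_bracketE sU tU) (cou_bracketE sV tV).
congr pair; last exact: lie_restr oU _ _ _ _.
apply/funext => x; change (restr V (tapply s.2 t.1) x = restr V s.2 x (restr V t.1)).
have [Vx|Vx] := pselect (V x); last by rewrite !restr_out.
have gV := smooth_on_subset VU gs.
(* On the right X acts on the restriction of g to V, which has the same germ as g at points of V. *)
rewrite !restr_in//; apply: (tangent_germ (vector_field_tangent XU (VU _ Vx))).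
- exact: smooth_on_at oV gV Vx.
- exact: smooth_on_at oV (smooth_on_restr oV gV) Vx.
- by apply: filterS (open_nbhs_nbhs (conj oV Vx)) => y Vy; rewrite restr_in.
Qed.

End Bracket.
End Poisson.

Theorem proposition5p6 (R : realType) (n : nat) (M : manifold R n)
    (E : M -> set (gvector R M))
    (hE : generalized_almost_complex E) :
  [/\
   (* (a) *)
   [/\ forall (U : set M) s t, open U -> COU E U s -> COU E U t ->
         COU E U (s + t),
       forall (U : set M) s t, open U -> COU E U s -> COU E U t ->
         COU E U (cou_mul s t),
       is_sheaf_of_comm_algebras (COU E) (@cou_res R n M) (@cou_ops R n M) &
       forall (U : set M) f g, open U -> admissible E U f ->
         admissible E U g -> admissible E U (f * g)],
   (* (b) *)
   forall m : M,
     is_local_ring_with (stalk (COU E) (@cou_res R n M) m)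
       (stalk_ops (COU E) (@cou_res R n M) (@cou_ops R n M) m)
       (vanishing_germs E m) &
   (* (c) *)
   integrable_structure E ->
   [/\ forall (U : set M) s t, open U -> COU E U s -> COU E U t ->
         COU E U (cou_bracket s t),
       forall (U : set M) s t, open U -> COU E U s -> COU E U t ->
         cou_bracket s t = (tapply s.2 t.1, lie s.2 t.2) &
       is_sheaf_of_poisson_algebras (COU E) (@cou_res R n M)
         (@cou_ops R n M) (@cou_bracket R n M)]].
Proof.
have subE m : is_subspace (E m) by case: (gac_isotropic hE m).
have isoE m : isotropic (E m) by case: (gac_isotropic hE m).
split; [split|exact: COU_stalk_local|move=> intE; split].
- by move=> U s t; exact: COUD.
- by move=> U s t; exact: COUM.
- exact: COU_sheaf_of_comm_algebras.
- move=> U f g oU [_ [X [_ fU]]] [_ [Y [_ gU]]]; have fgU := COUM subE oU fU gU.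
  by have [fg_smooth XY _] := fgU; split=> //; exists (cou_mul (f, X) (g, Y)).2.
- by move=> U s t; exact: COU_bracket.
- by move=> U s t _; exact: cou_bracketE.
- split; first exact: COU_sheaf_of_comm_algebras.
    by move=> U; exact: COU_poisson_algebra.
  by move=> U V s t; exact: COU_bracket_res.
Qed.
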